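(* Let $(X,d,\mu)$ be a space of homogeneous type, let $m\ge2$, and let $L$ be a non-negative self-adjoint operator on $L^2(X)$ satisfying the $m$-th order Davies–Gaffney estimates $(\mathrm{DG}_m)$. Then there exist two positive constants $C$ and $c$ such that for every $j=2,3,\ldots$, all $\tau\in\mathbb{R}$, all $R>0$, and all balls $B\subseteq X$ of radius $r$, $$\left\|P_Be^{(i\tau-1)R^{-1}L}P_{U_j(B)}\right\|_{2\to2}\le C\exp\left(-c\left(\frac{\sqrt[m]{R}\,2^jr}{\sqrt{1+\tau^2}}\right)^{\frac{m}{m-1}}\right).$$
   Context: Space of homogeneous type: $(X,d,\mu)$ is a metric measure space with distance $d$ and Borel measure $\mu$; $B(x,r)=\{y\in X:d(x,y)<r\}$, $V(x,r)=\mu(B(x,r))$, and the doubling property $V(x,2r)\le CV(x,r)$ holds for all $x\in X$, $r>0$. For $E\subseteq X$, $P_Ef=\chi_Ef$; $\|T\|_{2\to2}$ is the operator norm on $L^2(X)$. $(\mathrm{DG}_m)$: there exist constants $C,c>0$ such that for all $t>0$ and all $x,y\in X$, $$\big\|P_{B(x,t^{1/m})}e^{-tL}P_{B(y,t^{1/m})}\big\|_{2\to2}\le C\exp\left(-c\left(\frac{d(x,y)}{t^{1/m}}\right)^{\frac{m}{m-1}}\right).$$ For a ball $B=B(x_B,r)$ and $\lambda>0$, $\lambda B=B(x_B,\lambda r)$; $U_j(B)=2^jB\setminus2^{j-1}B$ for $j\geq 1$. The operator $e^{(i\tau-1)R^{-1}L}$ is defined on $L^2(X)$ by the spectral theorem.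 *)

(* Defs.v *)
From HB Require Import structures.
From mathcomp Require Import all_boot all_order all_algebra ring_quotient.
From mathcomp Require Import complex.
From mathcomp Require Import all_classical all_reals all_analysis.
From mathcomp Require Import measurable_realfun.

Set Implicit Arguments.
Unset Strict Implicit.
Unset Printing Implicit Defensive.

Import Order.TTheory GRing.Theory Num.Theory.
Import numFieldNormedType.Exports.
Import ComplexField.Normc.

Local Open Scope classical_set_scope.
Local Open Scope ring_scope.
Local Open Scope complex_scope.
Local Open Scope quotient_scope.

HB.mixin Record isBorelMetric (R : realType) (d : measure_display) T
    & Metric R T & Measurable d T := {
  measurable_borelE : @measurable d T = <<s [set A : set T | open A] >>
}.

#[short(type="borelMetricType")]
HB.structure Definition BorelMetric (R : realType) (d : measure_display) :=
  { T of Metric R T & Measurable d T & isBorelMetric R d T }.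

(* Finiteness of V(x, r) is part of the usual notion of a space of homogeneous
   type. Its positivity, which is also part of it, need not be required:
   by doubling, one null ball forces mu = 0. *)
Definition homogeneous_type (R : realType) (d : measure_display)
    (X : borelMetricType R d) (mu : {measure set X -> \bar R}) : Prop :=
  (forall (x : X) (r : R), 0 < r -> (mu (ball x r) < +oo)%E) /\
  (exists2 C : R, 0 < C & forall (x : X) (r : R), 0 < r ->
     (mu (ball x (2 * r)) <= C%:E * mu (ball x r))%E).

Section L2_space.
Context (R : realType) (d : measure_display) (X : measurableType d).
Variable mu : {measure set X -> \bar R}.

Definition cmeasurable (d' : measure_display) (Y : measurableType d')
    (D : set Y) (f : Y -> R[i]) : Prop :=
  measurable_fun D (@complex.Re R \o f) /\ measurable_fun D (@complex.Im R \o f).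

Definition sqr_integrable : {pred X -> R[i]} :=
  fun f => `[< cmeasurable setT f /\ finite_norm mu 2%:E (@normc R \o f) >].

Lemma cmeasurable_normc (d' : measure_display) (Y : measurableType d')
  (D : set Y) (f : Y -> R[i]) :
  measurable D -> cmeasurable D f -> measurable_fun D (@normc R \o f).
Proof.
move=> mD [mRe mIm].
have -> : @normc R \o f =
    (@Num.sqrt R) \o (fun x => complex.Re (f x) ^+ 2 + complex.Im (f x) ^+ 2).
  by apply/funext => x /=; case: (f x).
apply: (@measurableT_comp _ _ _ _ _ _ (@Num.sqrt R)).
  apply: subspace_continuous_measurable_fun => //.
  exact: (continuous_subspaceT (@sqrt_continuous R)).
by apply: measurable_funD; apply: measurable_funX.
Qed.

Lemma sqr_integrable_submod_closed : submod_closed sqr_integrable.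
Proof.
split.
  apply/asboolP; split; first by split; exact: measurable_cst.
  rewrite /finite_norm.
  have -> : EFin \o (@normc R \o (0 : X -> R[i])) = cst 0%E.
    by apply/funext => x /=; rewrite expr0n/= addr0 sqrtr0.
  by rewrite Lnorm0// eqe.
move=> a f g /asboolP[mf lf] /asboolP[mg lg]; apply/asboolP.
have maf : cmeasurable setT (a *: f).
  case: a mf => [a b] [mRe mIm]; split.
  - have -> : @complex.Re R \o ((a +i* b) *: f : X -> R[i]) =
      (fun x => a * complex.Re (f x) - b * complex.Im (f x)).
      by apply/funext => x; rewrite /= -[(_ *: _) x]/((a +i* b) * f x); case: (f x).
    by apply: measurable_funB; apply: measurable_funM.
  - have -> : @complex.Im R \o ((a +i* b) *: f : X -> R[i]) =
      (fun x => a * complex.Im (f x) + b * complex.Re (f x)).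
      by apply/funext => x; rewrite /= -[(_ *: _) x]/((a +i* b) * f x); case: (f x).
    by apply: measurable_funD; apply: measurable_funM.
have mafg : cmeasurable setT (a *: f + g).
  case: maf mg => [? ?] [? ?]; split.
  - have -> : @complex.Re R \o (a *: f + g : X -> R[i]) =
      (fun x => complex.Re ((a *: f) x) + complex.Re (g x)).
      by apply/funext => x; rewrite /= -[(_ + _) x]/((a *: f) x + g x);
         case: ((a *: f) x); case: (g x).
    exact: measurable_funD.
  - have -> : @complex.Im R \o (a *: f + g : X -> R[i]) =
      (fun x => complex.Im ((a *: f) x) + complex.Im (g x)).
      by apply/funext => x; rewrite /= -[(_ + _) x]/((a *: f) x + g x);
         case: ((a *: f) x); case: (g x).
    exact: measurable_funD.
split => //.
have nf : @normc R \o f \in Lfun mu 2%:E.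
  by rewrite inE; apply/andP; split; rewrite inE//=; exact: cmeasurable_normc.
have ng : @normc R \o g \in Lfun mu 2%:E.
  by rewrite inE; apply/andP; split; rewrite inE//=; exact: cmeasurable_normc.
have p1 : (1 <= 2%:E :> \bar R)%E by rewrite lee_fin ler1n.
have := @Lfun_submod_closed _ _ _ mu _ p1.
case=> _ /(_ (normc a) _ _ nf ng) /andP[_]; rewrite inE/=.
apply: le_lt_trans; rewrite unlock.
apply: gt0_ler_poweR; rewrite ?in_itv/= ?leey ?integral_ge0//.
apply: ge0_le_integral => //.
- apply/measurable_EFinP.
  apply: (@measurableT_comp _ _ _ _ _ _ (fun y : R => y `^ 2)).
    exact: measurable_powR.
  apply: measurableT_comp => //.
  exact: cmeasurable_normc.
- apply/measurable_EFinP.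
  apply: (@measurableT_comp _ _ _ _ _ _ (fun y : R => y `^ 2)).
    exact: measurable_powR.
  apply: measurableT_comp => //.
  apply: measurable_funD; last exact: cmeasurable_normc.
  by apply: measurable_funM => //; exact: cmeasurable_normc.
- move=> x _ /=; rewrite lee_fin ge0_ler_powR ?nnegrE//.
  have n0 (z : R[i]) : 0 <= normc z by case: z => ? ?; exact: sqrtr_ge0.
  have ? := n0 a; have ? := n0 (f x); have ? := n0 (g x).
  rewrite !ger0_norm ?addr_ge0 ?mulr_ge0//.
  by apply: (le_trans (le_normcD _ _)); rewrite normcM.
Qed.

HB.instance Definition _ := GRing.isSubmodClosed.Build _ _ sqr_integrable
  sqr_integrable_submod_closed.

Record L2fun := MkL2fun {
  L2fun_val :> X -> R[i];
  L2fun_valP : L2fun_val \in sqr_integrable }.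

HB.instance Definition _ := [isSub for L2fun_val].
HB.instance Definition _ := [Choice of L2fun by <:].
HB.instance Definition _ := [SubChoice_isSubLmodule of L2fun by <:].

Definition ae_null : {pred L2fun} :=
  fun f => `[< {ae mu, forall x, f x = 0} >].

Lemma ae_null_submod_closed : submod_closed ae_null.
Proof.
split; first by apply/asboolP; exact: aeW.
move=> a f g /asboolP f0 /asboolP g0; apply/asboolP.
apply: filterS2 f0 g0 => x fx0 gx0.
by rewrite -[LHS]/(a * f x + g x) fx0// gx0// mulr0 addr0.
Qed.

HB.instance Definition _ := GRing.isSubmodClosed.Build _ _ ae_null
  ae_null_submod_closed.

Definition L2 : Type := {ideal_quot ae_null}.

HB.instance Definition _ := Choice.on L2.
HB.instance Definition _ := GRing.Zmodule.on L2.
HB.instance Definition _ := EqQuotient.on L2.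

Definition L2_scale (a : R[i]) (u : L2) : L2 := \pi_L2 (a *: repr u).

Lemma L2_scale_pi a (f : L2fun) : L2_scale a (\pi_L2 f) = \pi_L2 (a *: f).
Proof.
apply/eqP; rewrite /L2_scale piE Quotient.equivE -scalerBr rpredZ//.
by rewrite Quotient.idealrBE reprK.
Qed.

Lemma L2_piD (f g : L2fun) : \pi_L2 (f + g) = \pi_L2 f + \pi_L2 g.
Proof. exact: Quotient.pi_add. Qed.

Lemma L2_scaleA a b u : L2_scale a (L2_scale b u) = L2_scale (a * b) u.
Proof.
rewrite -[u]reprK (L2_scale_pi b) (L2_scale_pi a) (L2_scale_pi (a * b)).
by rewrite scalerA.
Qed.

Lemma L2_scale1 : left_id 1 L2_scale.
Proof. by move=> u; rewrite -[u]reprK (L2_scale_pi 1) scale1r. Qed.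

Lemma L2_scaleDr : right_distributive L2_scale +%R.
Proof.
move=> a u v; rewrite -[u]reprK -[v]reprK -L2_piD.
by rewrite !(L2_scale_pi a) scalerDr L2_piD.
Qed.

Lemma L2_scaleDl u : {morph L2_scale^~ u : a b / a + b}.
Proof.
move=> a b; rewrite -[u]reprK (L2_scale_pi (a + b)).
by rewrite (L2_scale_pi a) (L2_scale_pi b) scalerDl L2_piD.
Qed.

HB.instance Definition _ := GRing.Zmodule_isLmodule.Build R[i] L2
  L2_scaleA L2_scale1 L2_scaleDr L2_scaleDl.

Definition L2_repr (u : L2) : X -> R[i] := repr u.
Coercion L2_repr : L2 >-> Funclass.

(* The class of f, and 0 when f is not square-integrable. *)
Definition toL2 (f : X -> R[i]) : L2 := \pi_L2 (insubd 0 f).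

Definition dotL2 (u v : L2) : R[i] :=
  (\int[mu]_x complex.Re (u x * conjc (v x))) +i*
  (\int[mu]_x complex.Im (u x * conjc (v x))).

Definition normL2 (u : L2) : R :=
  fine 'N[mu]_2%:E[EFin \o (@normc R \o u)].

Definition restrictL2 (E : set X) (u : L2) : L2 :=
  toL2 (fun x => (\1_E x)%:C * u x).

Definition opnorm (T : L2 -> L2) : \bar R :=
  ereal_sup [set (normL2 (T u))%:E | u in [set u | normL2 u <= 1]].

End L2_space.

Section Unbounded_operators.
Context (R : realType) (d : measure_display) (X : measurableType d).
Variable mu : {measure set X -> \bar R}.
Local Notation H := (L2 mu).

(* The values of opfun outside dom are irrelevant. *)
Record unbounded_op := UnboundedOp {
  dom : set H;
  opfun :> H -> H }.

Definition linear_op (L : unbounded_op) : Prop :=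
  dom L 0 /\
  forall (a : R[i]) (u v : H), dom L u -> dom L v ->
    dom L (a *: u + v) /\ L (a *: u + v) = a *: L u + L v.

Definition densely_defined (L : unbounded_op) : Prop :=
  forall (u : H) (e : R), 0 < e -> exists2 v, dom L v & normL2 (u - v) < e.

(* The graph of the adjoint of L. *)
Definition adjoint_graph (L : unbounded_op) (u w : H) : Prop :=
  forall v, dom L v -> dotL2 (L v) u = dotL2 v w.

Definition selfadjoint (L : unbounded_op) : Prop :=
  [/\ linear_op L, densely_defined L &
      forall u w, adjoint_graph L u w <-> (dom L u /\ L u = w)].

Definition nonnegative (L : unbounded_op) : Prop :=
  forall u, dom L u -> 0 <= dotL2 (L u) u.

Definition bounded_by (M : R) (g : R -> R[i]) : Prop :=
  forall s, 0 <= s -> normc (g s) <= M.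

Definition bounded_borel (g : R -> R[i]) : Prop :=
  cmeasurable (`[0, +oo[ : set (measurableTypeR R)) g /\ exists M, bounded_by M g.

(* The Borel functional calculus g |-> g(L) = \int g dE_L of a non-negative
   self-adjoint operator L, as provided (uniquely) by the spectral theorem.
   Since the spectrum of L lies in [0, +oo[, only the restriction of g to
   [0, +oo[ matters. *)
Record spectral_calculus (L : unbounded_op) (Phi : (R -> R[i]) -> H -> H)
    : Prop := {
  calculus_linear : forall g, bounded_borel g -> linear (Phi g);
  calculusD : forall g h u, bounded_borel g -> bounded_borel h ->
    Phi (fun s => g s + h s) u = Phi g u + Phi h u;
  calculusZ : forall a g u, bounded_borel g ->
    Phi (fun s => a * g s) u = a *: Phi g u;
  calculus1 : forall u, Phi (fun=> 1) u = u;
  calculusM : forall g h u, bounded_borel g -> bounded_borel h ->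
    Phi (fun s => g s * h s) u = Phi g (Phi h u);
  calculusJ : forall g u v, bounded_borel g ->
    dotL2 (Phi g u) v = dotL2 u (Phi (fun s => conjc (g s)) v);
  calculus_bound : forall g M u, bounded_borel g -> bounded_by M g ->
    normL2 (Phi g u) <= M * normL2 u;
  calculus_cvg : forall (h : nat -> R -> R[i]) g M u,
    (forall n, bounded_borel (h n)) -> bounded_borel g ->
    (forall n, bounded_by M (h n)) ->
    (forall s, 0 <= s -> normc (h n s - g s) @[n --> \oo] --> (0 : R)) ->
    normL2 (Phi (h n) u - Phi g u) @[n --> \oo] --> (0 : R);
  calculus_id : forall (h : nat -> R -> R[i]) u,
    (forall n, bounded_borel (h n)) ->
    (forall n s, 0 <= s -> normc (h n s) <= s) ->
    (forall s, 0 <= s -> normc (h n s - s%:C) @[n --> \oo] --> (0 : R)) ->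
    dom L u -> normL2 (Phi (h n) u - L u) @[n --> \oo] --> (0 : R) }.

Definition cexp (z : R[i]) : R[i] :=
  (expR (complex.Re z) * cos (complex.Im z)) +i*
  (expR (complex.Re z) * sin (complex.Im z)).

(* exp(z L), for Re z <= 0 *)
Definition expL (Phi : (R -> R[i]) -> H -> H) (z : R[i]) : H -> H :=
  Phi (fun s => cexp (z * s%:C)).

End Unbounded_operators.

Definition DaviesGaffney (R : realType) (d : measure_display)
    (X : borelMetricType R d) (mu : {measure set X -> \bar R}) (m : R)
    (Phi : (R -> R[i]) -> L2 mu -> L2 mu) : Prop :=
  exists C c : R, [/\ 0 < C, 0 < c &
    forall (t : R) (x y : X), 0 < t ->
      (opnorm (restrictL2 (ball x (t `^ m^-1)) \o expL Phi (- t)%:C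
               \o restrictL2 (ball y (t `^ m^-1)))%R
       <= (C * expR (- c * (mdist x y / t `^ m^-1) `^ (m / (m - 1))))%:E)%E].

(* U_j(B) for B = B(x, r) and j >= 1 *)
Definition annulus (R : realType) (X : metricType R) (x : X) (r : R) (j : nat)
    : set X :=
  ball x (2 ^+ j * r) `\` ball x (2 ^+ j.-1 * r).

(* Main.v *)
Require Import Defs.
From HB Require Import structures.
From mathcomp Require Import all_boot all_order all_algebra.
From mathcomp Require Import complex.
From mathcomp Require Import all_classical all_reals all_analysis.
From mathcomp Require Import ring_quotient measurable_realfun zify ring lra.

(* Let D = 2^j r. For real times t, cover the ball and the annulus by balls of
   radius t^(1/m): by doubling, the number of pairs is polynomial in D / t^(1/m)
   and is absorbed by the Davies-Gaffney factor.

   For a complex time z, the usual Phragmen-Lindelof argument is replaced by its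
   dual, an explicit approximation: e^{-z l} is approximated, uniformly in
   l >= 0, by a combination of n real exponentials e^{-s_k l} with
   0 < s_k <= |z|. The error is the Blaschke product
   \prod_k |z - s_k| / |z + s_k| <= exp (- n cos (arg z) / 8), and the absolute
   values of the coefficients add up to at most 4 exp (5 n). The functional
   calculus turns this into an approximation of e^{-zL} by real-time operators,
   and n is taken proportional to (D / |z|^(1/m))^(m/(m-1)). *)

Set Implicit Arguments.
Unset Strict Implicit.
Unset Printing Implicit Defensive.

Import Order.TTheory GRing.Theory Num.Theory.
Import numFieldNormedType.Exports.
Import ComplexField.Normc.

Local Open Scope classical_set_scope.
Local Open Scope ring_scope.
Local Open Scope complex_scope.

(** * The space L2 *)

(** Phragmen-Lindelof would use the analyticity of z -> e^{-zL}; the dual argument needs only the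
    algebraic rules of the functional calculus and its sup-norm bound. The price is that the scalar
    error must be small in sup norm on [0, oo), whereas the Blaschke product is by nature the L^2(0,
    oo) distance, up to normalisation, from e^{-z l} to the span of the real exponentials. One
    integration against a decaying exponential makes the bound pointwise and keeps the product. Two
    rates compete. Nodes beyond |z| would spoil the real-time bound, which deteriorates as time
    grows; nodes confined to (0, |z|] are paid for by coefficients of size exp (5 n). The real-time
    factor exp (- c1 M), with M = (D / |z|^(1/m))^(m/(m-1)), absorbs them as long as 5 n <= c1 M /
    2, and the interpolation error then has an exponent proportional to M cos (arg z). For |z| =
    sqrt (1 + tau^2) / R and cos (arg z) = 1 / sqrt (1 + tau^2) this is exactly the claimed
    quantity, since (1 - 1/m) m/(m-1) = 1. *)

Lemma normc_ge0 (R : rcfType) (z : R[i]) : 0 <= normc z.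
Proof. by case: z => ? ?; exact: sqrtr_ge0. Qed.

Lemma Re_realM (R : rcfType) (r : R) (z : R[i]) :
  complex.Re (r%:C * z) = r * complex.Re z.
Proof. by case: z => a b /=; rewrite mul0r subr0. Qed.

Lemma Im_realM (R : rcfType) (r : R) (z : R[i]) :
  complex.Im (r%:C * z) = r * complex.Im z.
Proof. by case: z => a b /=; rewrite mul0r addr0. Qed.

Section L2_norm.
Local Open Scope quotient_scope.
Context (R : realType) (d : measure_display) (X : measurableType d).
Variable mu : {measure set X -> \bar R}.
Local Notation H := (L2 mu).
Implicit Types (u v : H) (f g : X -> R) (A B : set X).

Lemma measurable_abse_sqr f : measurable_fun setT f ->
  measurable_fun setT (fun x => (`|(f x)%:E| `^ 2)%E).
Proof.
move=> mf; apply/measurable_EFinP.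
apply: (@measurableT_comp _ _ _ _ _ _ (fun y : R => y `^ 2)).
  exact: measurable_powR.
exact: measurableT_comp.
Qed.

Lemma ae_le_Lnorm2 f g :
  measurable_fun setT f -> measurable_fun setT g ->
  {ae mu, forall x, `|f x| <= `|g x|} ->
  ('N[mu]_2%:E[EFin \o f] <= 'N[mu]_2%:E[EFin \o g])%E.
Proof.
move=> mf mg fg; rewrite unlock.
apply: gt0_ler_poweR; rewrite ?in_itv/= ?leey ?integral_ge0//.
apply: ae_ge0_le_integral => //; try exact: measurable_abse_sqr.
apply: filterS fg => x fgx _ /=.
by rewrite lee_fin ge0_ler_powR ?nnegrE.
Qed.

Lemma measurable_normc_L2 u : measurable_fun setT (fun x => normc (u x)).
Proof. by have /asboolP[mu_ _] := L2fun_valP (repr u); exact: cmeasurable_normc. Qed.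

Lemma Lnorm_L2_fin u : ('N[mu]_2%:E[EFin \o (fun x => normc (u x))] < +oo)%E.
Proof. by have /asboolP[_ ?] := L2fun_valP (repr u). Qed.

Lemma normL2E u :
  (normL2 u)%:E = 'N[mu]_2%:E[EFin \o (fun x => normc (u x))]%E.
Proof.
rewrite /normL2 fineK// ge0_fin_numE ?Lnorm_ge0//; exact: Lnorm_L2_fin.
Qed.

Lemma normL2_ge0 u : 0 <= normL2 u.
Proof. by rewrite -lee_fin normL2E Lnorm_ge0. Qed.

(** The chosen representatives of classes do not respect the operations, so pointwise identities
    hold only almost everywhere; they all come from this one. *)
Lemma repr_piE (h : L2fun mu) :
  {ae mu, forall x, (\pi_(L2 mu) h : H) x = h x}.
Proof.
have : \pi_(L2 mu) (repr (\pi_(L2 mu) h)) == \pi_(L2 mu) h :> H by rewrite reprK.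
rewrite piE Quotient.equivE => /asboolP; apply: filterS => x.
by rewrite -[X in X = 0 -> _]/(repr (\pi_(L2 mu) h) x - h x) => /eqP; rewrite subr_eq0 => /eqP.
Qed.

Lemma L2_eq_ae u v : {ae mu, forall x, u x = v x} -> u = v.
Proof.
move=> uv; rewrite -[u]reprK -[v]reprK; apply/eqP.
rewrite piE Quotient.equivE; apply/asboolP; apply: filterS uv => x uvx.
by rewrite -[LHS]/(u x - v x) uvx subrr.
Qed.

Lemma L2_reprD u v : {ae mu, forall x, L2_repr (u + v) x = u x + v x}.
Proof.
have := repr_piE (repr u + repr v); apply: filterS => x.
by rewrite L2_piD !reprK => ->.
Qed.

Lemma L2_reprZ (a : R[i]) u : {ae mu, forall x, L2_repr (a *: u) x = a * u x}.
Proof. exact: (repr_piE (a *: repr u)). Qed.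

Lemma L2_repr0 : {ae mu, forall x, L2_repr (0 : H) x = 0}.
Proof.
have <- : \pi_(L2 mu) (0 : L2fun mu) = 0 :> H.
  by apply: (addrI (\pi_(L2 mu) (0 : L2fun mu) : H)); rewrite addr0 -L2_piD addr0.
by apply: filterS (repr_piE 0) => x ->.
Qed.

Lemma normL2D u v : normL2 (u + v) <= normL2 u + normL2 v.
Proof.
rewrite -lee_fin EFinD !normL2E.
have mu_ := @measurable_normc_L2 u; have mv := @measurable_normc_L2 v.
apply: (le_trans _ (eminkowski _ _ _ _)) => //; last by rewrite lee_fin ler1n.
apply: ae_le_Lnorm2; [exact: measurable_normc_L2|exact: measurable_funD|].
apply: filterS (L2_reprD u v) => x ->.
rewrite !ger0_norm ?addr_ge0 ?normc_ge0//; exact: le_normcD.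
Qed.

Lemma normL2Z (a : R[i]) u : normL2 (a *: u) <= normc a * normL2 u.
Proof.
rewrite -lee_fin EFinM !normL2E.
have mu_ := @measurable_normc_L2 u.
have -> : ((normc a)%:E * 'N[mu]_2%:E[EFin \o (fun x => normc (u x))] =
    'N[mu]_2%:E[EFin \o (fun x => (normc a * normc (u x))%R)])%E.
  rewrite unlock.
  under [in RHS]eq_integral => x _.
    rewrite /= normrM powRM// EFinM; over.
  rewrite ge0_integralZl//; last exact: measurable_abse_sqr.
  rewrite [RHS]poweRM ?integral_ge0// ?lee_fin ?powR_ge0//.
  by rewrite poweR_EFin -powRrM mulfV// powRr1 ?normr_ge0// ger0_norm ?normc_ge0.
apply: ae_le_Lnorm2; [exact: measurable_normc_L2|exact: measurable_funM|].
by apply: filterS (L2_reprZ a u) => x ->; rewrite normcM.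
Qed.

Lemma sqr_integrable_restrict A u : measurable A ->
  (fun x => (\1_A x)%:C * u x) \in @sqr_integrable _ _ _ mu.
Proof.
move=> mA; have /asboolP[[mr mi] lu] := L2fun_valP (repr u).
have mu_ := @measurable_normc_L2 u.
have m1 : cmeasurable setT (fun x => (\1_A x)%:C * u x).
  split.
  - rewrite (_ : _ \o _ = (fun x => \1_A x * complex.Re (u x))); last first.
      by apply/funext => x; exact: Re_realM.
    exact: measurable_funM.
  - rewrite (_ : _ \o _ = (fun x => \1_A x * complex.Im (u x))); last first.
      by apply/funext => x; exact: Im_realM.
    exact: measurable_funM.
apply/asboolP; split => //; apply: le_lt_trans lu.
apply: ae_le_Lnorm2 => //; first exact: cmeasurable_normc.
apply: aeW => x /=; rewrite normcM !ger0_norm ?mulr_ge0 ?normc_ge0//.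
rewrite /indic; case: (_ \in _); last by rewrite normc0 mul0r normc_ge0.
by rewrite normc1 mul1r.
Qed.

Lemma restrictL2_repr A u : measurable A ->
  {ae mu, forall x, L2_repr (restrictL2 A u) x = (\1_A x)%:C * u x}.
Proof.
move=> mA; rewrite /restrictL2 /toL2.
have := repr_piE (insubd 0 (fun x => (\1_A x)%:C * u x)); apply: filterS => x ->.
by rewrite insubdK//; exact: sqr_integrable_restrict.
Qed.

Lemma restrictL2U A B u : measurable A -> measurable B -> A `&` B = set0 ->
  restrictL2 (A `|` B) u = restrictL2 A u + restrictL2 B u.
Proof.
move=> mA mB AB0; apply: L2_eq_ae.
near=> x.
have -> : L2_repr (restrictL2 (A `|` B) u) x = (\1_(A `|` B) x)%:C * u x.
  by near: x; apply: restrictL2_repr; exact: measurableU.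
have -> : L2_repr (restrictL2 A u + restrictL2 B u) x =
    restrictL2 A u x + restrictL2 B u x by near: x; exact: L2_reprD.
have -> : L2_repr (restrictL2 A u) x = (\1_A x)%:C * u x.
  by near: x; exact: restrictL2_repr.
have -> : L2_repr (restrictL2 B u) x = (\1_B x)%:C * u x.
  by near: x; exact: restrictL2_repr.
rewrite -mulrDl -rmorphD /=; congr (_%:C * _).
rewrite !indicE in_setU; have [xA|] := boolP (x \in A); last by rewrite add0r.
rewrite (_ : x \in B = false) ?addr0//.
apply/negP; rewrite inE => xB; have : (A `&` B) x by split => //; rewrite inE in xA.
by rewrite AB0.
Unshelve. all: by end_near.
Qed.

Lemma restrictL2I A B u : measurable A -> measurable B ->
  restrictL2 A (restrictL2 B u) = restrictL2 (A `&` B) u.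
Proof.
move=> mA mB; apply: L2_eq_ae.
near=> x.
have -> : L2_repr (restrictL2 A (restrictL2 B u)) x = (\1_A x)%:C * restrictL2 B u x.
  by near: x; exact: restrictL2_repr.
have -> : L2_repr (restrictL2 B u) x = (\1_B x)%:C * u x.
  by near: x; exact: restrictL2_repr.
have -> : L2_repr (restrictL2 (A `&` B) u) x = (\1_(A `&` B) x)%:C * u x.
  by near: x; apply: restrictL2_repr; exact: measurableI.
by rewrite mulrA indicI /= rmorphM.
Unshelve. all: by end_near.
Qed.

Lemma restrictL2_0 A : measurable A -> restrictL2 A (0 : H) = 0.
Proof.
move=> mA; apply: L2_eq_ae.
apply: filterS2 (restrictL2_repr 0 mA) L2_repr0 => x -> ->.
by rewrite mulr0.
Qed.

Lemma restrictL2D A u v : measurable A ->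
  restrictL2 A (u + v) = restrictL2 A u + restrictL2 A v.
Proof.
move=> mA; apply: L2_eq_ae.
near=> x.
have -> : L2_repr (restrictL2 A (u + v)) x = (\1_A x)%:C * (u + v : H) x.
  by near: x; exact: restrictL2_repr.
have -> : L2_repr (u + v) x = u x + v x by near: x; exact: L2_reprD.
have -> : L2_repr (restrictL2 A u + restrictL2 A v) x =
    restrictL2 A u x + restrictL2 A v x by near: x; exact: L2_reprD.
have -> : L2_repr (restrictL2 A u) x = (\1_A x)%:C * u x.
  by near: x; exact: restrictL2_repr.
have -> : L2_repr (restrictL2 A v) x = (\1_A x)%:C * v x.
  by near: x; exact: restrictL2_repr.
exact: mulrDr.
Unshelve. all: by end_near.
Qed.

Lemma restrictL2Z A (a : R[i]) u : measurable A ->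
  restrictL2 A (a *: u) = a *: restrictL2 A u.
Proof.
move=> mA; apply: L2_eq_ae.
near=> x.
have -> : L2_repr (restrictL2 A (a *: u)) x = (\1_A x)%:C * (a *: u : H) x.
  by near: x; exact: restrictL2_repr.
have -> : L2_repr (a *: u) x = a * u x by near: x; exact: L2_reprZ.
have -> : L2_repr (a *: restrictL2 A u) x = a * restrictL2 A u x.
  by near: x; exact: L2_reprZ.
have -> : L2_repr (restrictL2 A u) x = (\1_A x)%:C * u x.
  by near: x; exact: restrictL2_repr.
exact: mulrCA.
Unshelve. all: by end_near.
Qed.

Lemma normL2_0 : normL2 (0 : H) = 0.
Proof.
apply/eqP; rewrite eq_le normL2_ge0 andbT -[leLHS](congr1 _ (scale0r 0)).
by rewrite (le_trans (normL2Z _ _))// normc0 mul0r.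
Qed.

Lemma normL2_restrict A u : measurable A -> normL2 (restrictL2 A u) <= normL2 u.
Proof.
move=> mA; rewrite -lee_fin !normL2E.
apply: ae_le_Lnorm2; try exact: measurable_normc_L2.
have := restrictL2_repr u mA; apply: filterS => x ->.
rewrite normcM !ger0_norm ?mulr_ge0 ?normc_ge0//.
rewrite /indic; case: (_ \in _); last by rewrite normc0 mul0r normc_ge0.
by rewrite normc1 mul1r.
Qed.

Lemma restrictL2_null A u : measurable A -> mu A = 0%E -> restrictL2 A u = 0.
Proof.
move=> mA A0; apply: L2_eq_ae.
have nA : {ae mu, forall x, ~ A x}.
  by exists A; split => //; move=> x /=; exact: contrapT.
apply: filterS3 nA (restrictL2_repr u mA) L2_repr0 => x nAx -> ->.
by rewrite indicE memNset// mul0r.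
Qed.

End L2_norm.

(** * Interpolation of a complex exponential by real ones *)

Lemma normc_real (R : rcfType) (r : R) : normc r%:C = `|r|.
Proof. by rewrite /normc /= expr0n addr0 sqrtr_sqr. Qed.

Lemma Re_le_normc (R : rcfType) (w : R[i]) : complex.Re w <= normc w.
Proof.
case: w => a b; rewrite /normc /=; apply: (le_trans (ler_norm a)).
by rewrite -sqrtr_sqr ler_wsqrtr// lerDl sqr_ge0.
Qed.

Lemma sqr_normc (R : rcfType) (w : R[i]) :
  normc w ^+ 2 = complex.Re w ^+ 2 + complex.Im w ^+ 2.
Proof. by case: w => a b; rewrite /normc /= sqr_sqrtr// addr_ge0// sqr_ge0. Qed.

(** * Derivatives of complex-valued functions of a real variable *)

Section complex_derivative.
Context (R : realType).
Implicit Types (f g : R -> R[i]) (c : R[i]).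

Definition cderive f f' := forall l : R,
  is_derive l 1 (fun t => complex.Re (f t)) (complex.Re (f' l)) /\
  is_derive l 1 (fun t => complex.Im (f t)) (complex.Im (f' l)).

Lemma cderiveD f f' g g' : cderive f f' -> cderive g g' ->
  cderive (fun t => f t + g t) (fun t => f' t + g' t).
Proof.
move=> df dg l; have [fr fi] := df l; have [gr gi] := dg l; split.
- rewrite (_ : (fun t => _) = (fun t => complex.Re (f t)) \+ (fun t => complex.Re (g t))).
    by apply: is_derive_eq; case: (f' l) (g' l) => ? ? [].
  by apply/funext => t /=; case: (f t) (g t) => ? ? [].
- rewrite (_ : (fun t => _) = (fun t => complex.Im (f t)) \+ (fun t => complex.Im (g t))).
    by apply: is_derive_eq; case: (f' l) (g' l) => ? ? [].
  by apply/funext => t /=; case: (f t) (g t) => ? ? [].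
Qed.

Lemma cderiveZ c f f' : cderive f f' ->
  cderive (fun t => c * f t) (fun t => c * f' t).
Proof.
case: c => a b df l; have [fr fi] := df l; split.
- rewrite (_ : (fun t => _) = a \*: (fun t => complex.Re (f t)) \- b \*: (fun t => complex.Im (f t))).
    by apply: is_derive_eq; case: (f' l).
  by apply/funext => t /=; case: (f t).
- rewrite (_ : (fun t => _) = a \*: (fun t => complex.Im (f t)) \+ b \*: (fun t => complex.Re (f t))).
    by apply: is_derive_eq; case: (f' l).
  by apply/funext => t /=; case: (f t).
Qed.

Lemma cderive_sum n (f f' : nat -> R -> R[i]) :
  (forall k, (k < n)%N -> cderive (f k) (f' k)) ->
  cderive (fun t => \sum_(k < n) f k t) (fun t => \sum_(k < n) f' k t).
Proof.
elim: n => [|n IH] df.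
  move=> l; split.
  - under eq_fun => t do rewrite big_ord0.
    by rewrite big_ord0; exact: is_derive_cst.
  - under eq_fun => t do rewrite big_ord0.
    by rewrite big_ord0; exact: is_derive_cst.
have := cderiveD (IH (fun k kn => df k (ltnW kn))) (df n (leqnn _)).
move=> H l; have [Hr Hi] := H l; rewrite big_ord_recr/=; split.
- by under eq_fun => t do rewrite big_ord_recr/=.
- by under eq_fun => t do rewrite big_ord_recr/=.
Qed.

Lemma cexp_realM c (l : R) : cexp (c * l%:C) =
  (expR (complex.Re c * l) * cos (complex.Im c * l)) +i*
  (expR (complex.Re c * l) * sin (complex.Im c * l)).
Proof. by case: c => a b; rewrite /cexp /= !mulr0 subr0 add0r. Qed.

Lemma cderive_cexp c : cderive (fun t => cexp (c * t%:C)) (fun t => c * cexp (c * t%:C)).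
Proof.
case: c => a b l; split.
- rewrite (_ : (fun t => _) =
    (fun t => expR (a * t) * cos (b * t))); last first.
    by apply/funext => t; rewrite cexp_realM.
  by apply: is_derive_eq; rewrite cexp_realM /= /GRing.scale /=; ring.
- rewrite (_ : (fun t => _) =
    (fun t => expR (a * t) * sin (b * t))); last first.
    by apply/funext => t; rewrite cexp_realM.
  by apply: is_derive_eq; rewrite cexp_realM /= /GRing.scale /=; ring.
Qed.

End complex_derivative.

(** * The interpolation residual: Laplace transform, energy, sup bound *)

Section exponential_interpolation.
Context (R : realType).
Variables (z : R[i]) (s : nat -> R).
Hypothesis z_gt0 : 0 < complex.Re z.
Hypothesis s_gt0 : forall k, 0 < s k.
Hypothesis s_inj : injective s.
Hypothesis zs : forall k, z != (s k)%:C.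
Local Notation zb := (conjc z).

(** The target exponent z takes index 0 and the nodes follow, so that one recursion treats both; the
    poles of the Laplace transform are the numbers [- pole k]. *)
Definition pole k : R[i] := if k is k'.+1 then (s k')%:C else z.
Local Arguments pole : simpl never.
Local Notation p := pole.

(* Up to normalisation, the residual of the best L^2(0, oo) approximation of
   e^{-z l} by e^{-s_0 l}, ..., e^{-s_(n-1) l} is the function g n below, whose
   Laplace transform is (w + z)^-1 * \prod_j (w - s_j) / (w + s_j). It is built
   one node at a time: h n is the convolution of g n with e^{-s_n l}, and
   multiplying the transform by (w - s) / (w + s) amounts to g - 2 s h. *)
Fixpoint interp_coef n k : R[i] :=
  if n is n'.+1 then
    if k == n'.+1 then
      2 * p n'.+1 * \sum_(i < n'.+1) interp_coef n' i / (p n'.+1 - p i)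
    else interp_coef n' k * ((p k + p n'.+1) / (p k - p n'.+1))
  else 1.

Let E k (l : R) : R[i] := cexp (- p k * l%:C).
Let g n l := \sum_(k < n.+1) interp_coef n k * E k l.
Let h n l :=
  \sum_(k < n.+1) interp_coef n k / (p n.+1 - p k) * (E k l - E n.+1 l).
(* phi n l = 2 Re z \int_l^oo g n v e^{- zb (v - l)} dv. Unlike g n it is bounded
   pointwise, uniformly in z, and the coefficient of e^{-z l} is the same. *)
Let phi n l := \sum_(k < n.+1) interp_coef n k * ((z + zb) / (p k + zb)) * E k l.

Let p_gt0 k : 0 < complex.Re (p k).
Proof. by case: k => [//|k]; exact: s_gt0. Qed.

Let p_inj i j : (i < j)%N -> p i - p j != 0.
Proof.
rewrite subr_eq0 /pole; case: i j => [|i] [|j]//= ij.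
by apply/eqP => -[/s_inj ijE]; rewrite ijE ltnn in ij.
Qed.

Let Re_gt0_neq0 (w : R[i]) : 0 < complex.Re w -> w != 0.
Proof. by apply: contraTneq => ->; rewrite ltxx. Qed.

Let Re_add (w v : R[i]) : complex.Re (w + v) = complex.Re w + complex.Re v.
Proof. by case: w v => ? ? [? ?]. Qed.

Let pD_neq0 i j : p i + p j != 0.
Proof. by apply: Re_gt0_neq0; rewrite Re_add addr_gt0. Qed.

Let pzb_neq0 i : p i + zb != 0.
Proof.
apply: Re_gt0_neq0; rewrite Re_add addr_gt0//.
by move: z_gt0; case: (z).
Qed.

Lemma interp_coef_lt n k : (k < n.+1)%N ->
  interp_coef n.+1 k = interp_coef n k * ((p k + p n.+1) / (p k - p n.+1)).
Proof. by move=> kn /=; rewrite ltn_eqF. Qed.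

Lemma interp_coef_last n : interp_coef n.+1 n.+1 =
  2 * p n.+1 * \sum_(i < n.+1) interp_coef n i / (p n.+1 - p i).
Proof. by rewrite /= eqxx. Qed.

(** Partial fractions: multiplying c / (w + r) by (w - q) / (w + q) gives c (r + q) / (r - q) / (w +
    r) plus a multiple of 1 / (w + q), which is the recursion for the coefficients. *)
Lemma interp_laplaceE n (w : R[i]) : (forall k, (k <= n)%N -> w + p k != 0) ->
  \sum_(k < n.+1) interp_coef n k / (w + p k) =
  (w + z)^-1 * \prod_(j < n) ((w - p j.+1) / (w + p j.+1)).
Proof.
elim: n => [|n IH] wp.
  by rewrite big_ord_recl !big_ord0 addr0 mulr1 mul1r.
rewrite big_ord_recr [in RHS]big_ord_recr/= [RHS]mulrA -IH; last first.
  by move=> k kn; apply: wp; exact: leqW.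
rewrite eqxx mulr_sumr mulr_suml -big_split/= mulr_suml.
apply: eq_bigr => -[k kn] _ /=; rewrite ltn_eqF//.
have := wp k (ltnW kn); have := wp _ (leqnn n.+1); have := p_inj kn.
move: (p n.+1) (p k) (interp_coef n k) => q r c qr wq wr.
by field; rewrite -opprB oppr_eq0 qr wq wr.
Qed.

Lemma residualS n l : g n.+1 l = g n l - 2 * p n.+1 * h n l.
Proof.
rewrite /g /h big_ord_recr/= eqxx mulr_sumr mulr_suml mulr_sumr -sumrB -big_split/=.
apply: eq_bigr => -[k kn] _ /=; rewrite ltn_eqF//.
have := p_inj kn; move: (p n.+1) (p k) (interp_coef n k) (E k l) (E n.+1 l) => q r c e f qr.
by field; rewrite -opprB oppr_eq0 qr.
Qed.

(** Let A f (l) be the integral of f(v) e^{- zb (v - l)} over v >= l. Since h' = g - q h with q =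
    [p n.+1], integration by parts gives (zb + q) A h = A g + h; inserting this in A (g - 2 q h)
    yields the recursion. The proof verifies it coefficient by coefficient. *)
Lemma projectionS n l : phi n.+1 l = (zb - p n.+1) / (zb + p n.+1) * phi n l -
  2 * p n.+1 * (z + zb) / (zb + p n.+1) * h n l.
Proof.
rewrite /phi /h big_ord_recr/= eqxx !mulr_sumr !mulr_suml -sumrB -big_split/=.
apply: eq_bigr => -[k kn] _ /=; rewrite ltn_eqF//.
have := p_inj kn; have := pzb_neq0 k; have := pzb_neq0 n.+1.
move: (p n.+1) (p k) (interp_coef n k) (E k l) (E n.+1 l) => q r c e f qb rb qr.
have qb2 : zb + q != 0 by rewrite addrC.
field; apply/and4P; split => //.
by rewrite -opprB oppr_eq0.
Qed.


Let dE k : cderive (E k) (fun l => - p k * E k l).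
Proof. exact: cderive_cexp. Qed.

Lemma cderive_convolution n : cderive (h n) (fun l => g n l - p n.+1 * h n l).
Proof.
rewrite /h.
have := @cderive_sum _ n.+1
  (fun k l => interp_coef n k / (p n.+1 - p k) * (E k l + (-1) * E n.+1 l))
  (fun k l => interp_coef n k / (p n.+1 - p k) * (- p k * E k l + (-1) * (- p n.+1 * E n.+1 l))).
have -> : (fun l : R => \sum_(k < n.+1) interp_coef n k / (p n.+1 - p k) * (- p k * E k l + -1 * (- p n.+1 * E n.+1 l))) = (fun l => g n l - p n.+1 * h n l).
  apply/funext => l; rewrite /g /h mulr_sumr -sumrB.
  apply: eq_bigr => -[k kn] _ /=.
  have := p_inj kn; move: (p n.+1) (p k) (interp_coef n k) (E k l) (E n.+1 l) => q r c e f qr.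
  by field; rewrite -opprB oppr_eq0 qr.
have -> : (fun t : R => \sum_(k < n.+1) interp_coef n k / (p n.+1 - p k) * (E k t + -1 * E n.+1 t)) = h n.
  by apply/funext => l; apply: eq_bigr => k _; rewrite mulN1r.
apply=> k kn; apply: cderiveZ; apply: cderiveD; first exact: dE.
by apply: cderiveZ; exact: dE.
Qed.

Let sq (w : R[i]) := complex.Re w ^+ 2 + complex.Im w ^+ 2.
Let x := complex.Re z.
(* Q n l = \int_l^oo |g n|^2: convolution steps preserve the L^2 norm because
   |g - 2 s h|^2 = |g|^2 - 2 s (|h|^2)' when h' = - s h + g. *)
Let Q (n : nat) (l : R) : R := expR (- (2 * x) * l) / (2 * x) +
  \sum_(j < n) 2 * s j * sq (h j l).

Lemma derive_energy (n : nat) (l : R) : is_derive l 1 (Q n) (- sq (g n l)).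
Proof.
elim: n => [|n IH].
  rewrite (_ : Q 0 = fun l : R => expR (- (2 * x) * l) / (2 * x)); last first.
    by apply/funext => t; rewrite /Q big_ord0 addr0.
  apply: is_derive_eq.
  rewrite /g big_ord_recl big_ord0 addr0 mul1r /sq /E cexp_realM /GRing.scale /=.
  have -> : complex.Re (- p 0) = - x by rewrite /pole /x; case: (z).
  move: (complex.Im (- p 0)) => b.
  rewrite !exprMn -mulrDr cos2Dsin2 mulr1 expr2 -expRD.
  have -> : - x * l + - x * l = - (2 * x) * l by ring.
  by field; rewrite gt_eqF.
rewrite (_ : Q n.+1 = (Q n) \+ (fun l : R => 2 * s n * (complex.Re (h n l) ^+ 2 + complex.Im (h n l) ^+ 2))); last first.
  by apply/funext => t; rewrite /Q big_ord_recr/= addrA.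
have [hr hi] := cderive_convolution n l.
apply: is_derive_eq; rewrite residualS {2 3 4 5}/pole.
have -> : 2 * (s n)%:C = (2 * s n)%:C :> R[i] by rewrite rmorphM rmorph_nat.
move: (g n l) (h n l) => [a b] [c e].
by rewrite /sq /GRing.scale /=; ring.
Qed.

(** The energy decreases in l, and at l = 0 every convolution [h j] vanishes, which leaves the total
    energy of e^{-z l}. *)
Lemma energy_le n l : 0 <= l -> Q n l <= (2 * x)^-1.
Proof.
move=> l0.
have -> : (2 * x)^-1 = Q n 0.
  rewrite /Q mulr0 expR0 mul1r big1 ?addr0// => j _.
  rewrite /h big1 ?/sq /= ?expr0n ?addr0 ?mulr0// => k _.
  by rewrite /E !mulr0 subrr mulr0.
have [|c _ QE] := MVT_segment l0 (fun t _ => derive_energy n t).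
  apply: continuous_subspaceT => t.
  apply: differentiable_continuous; apply/derivable1_diffP.
  by have [] := derive_energy n t.
rewrite -subr_le0 QE subr0 mulNr oppr_le0 mulr_ge0//.
by rewrite addr_ge0// sqr_ge0.
Qed.

(** This is Cauchy-Schwarz in the integral behind [phi], the exponential e^{- zb v} having energy 1
    / (2 x). The induction avoids the integral and applies Cauchy-Schwarz in dimension two at each
    node. *)
Lemma projection_le_energy n l : normc (phi n l) ^+ 2 <= 2 * x * Q n l.
Proof.
elim: n => [|n IH].
  rewrite /Q /phi big_ord_recl !big_ord0 !addr0 mul1r divff ?mul1r; last exact: (pzb_neq0 0).
  rewrite sqr_normc /E cexp_realM /sq /=.
  have -> : complex.Re (- p 0) = - x by rewrite /pole /x; case: (z).
  move: (complex.Im (- p 0)) => b.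
  rewrite !exprMn -mulrDr cos2Dsin2 mulr1 expr2 -expRD.
  have -> : - x * l + - x * l = - (2 * x) * l by ring.
  by rewrite mulrCA divff ?mulr1// gt_eqF ?mulr_gt0.
have -> : Q n.+1 l = Q n l + 2 * s n * normc (h n l) ^+ 2.
  by rewrite /Q big_ord_recr/= addrA sqr_normc.
set A := normc ((zb - p n.+1) / (zb + p n.+1)).
set B := normc (2 * p n.+1 * (z + zb) / (zb + p n.+1)).
have leAB : normc (phi n.+1 l) <= A * normc (phi n l) + B * normc (h n l).
  rewrite projectionS; apply: (le_trans (le_normcD _ _)).
  by rewrite normcN [normc (_ * phi n l)]normcM [normc (_ * h n l)]normcM.
(* Amounts to |zb - s|^2 + 4 x s = |zb + s|^2 with s = [s n]. *)
have AB : A ^+ 2 + B ^+ 2 / (4 * x * s n) = 1.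
  have x0 : 0 < x by [].
  have xE : z = x +i* complex.Im z by rewrite /x; case: (z).
  have zbE : zb = x +i* - complex.Im z by rewrite xE.
  have -> : B = (2 * s n) * (2 * x) / normc (zb + p n.+1).
    rewrite /B; have -> : z + zb = (2 * x)%:C.
      by rewrite zbE {1}xE; apply/eqP; rewrite eq_complex /= subrr eqxx andbT; apply/eqP; ring.
    have -> : 2 * p n.+1 = (2 * s n)%:C by rewrite rmorphM rmorph_nat.
    by rewrite !normcM normcV !normc_real !ger0_norm ?mulr_ge0// ltW.
  rewrite /A normcM normcV !exprMn !exprVn !sqr_normc /sq zbE /pole /= addr0 subr0.
  field; apply/and3P; split; rewrite gt_eqF//.
  by rewrite ltr_pwDl ?sqr_ge0// exprn_gt0// addr_gt0.
have k0 : 0 < 4 * x * s n by rewrite !mulr_gt0.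
move: IH leAB AB; move: (normc_ge0 (phi n.+1 l)) (normc_ge0 (phi n l)) (normc_ge0 (h n l)).
move: (normc (phi n l)) (normc (h n l)) (normc (phi n.+1 l)) => a b c c0 a0 b0 IH leAB AB.
have A0 : 0 <= A by exact: normc_ge0.
have B0 : 0 <= B by exact: normc_ge0.
apply: (@le_trans _ _ ((A * a + B * b) ^+ 2)).
  by rewrite ler_sqr ?nnegrE// addr_ge0// mulr_ge0.
apply: (@le_trans _ _ (a ^+ 2 + 4 * x * s n * b ^+ 2)).
  set k := 4 * x * s n in k0 AB *.
  have -> : a ^+ 2 + k * b ^+ 2 = (A ^+ 2 + B ^+ 2 / k) * (a ^+ 2 + k * b ^+ 2).
    by rewrite AB mul1r.
  rewrite -subr_ge0.
  have -> : (A ^+ 2 + B ^+ 2 / k) * (a ^+ 2 + k * b ^+ 2) - (A * a + B * b) ^+ 2 = (A * k * b - B * a) ^+ 2 / k.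
    by field; rewrite gt_eqF.
  by rewrite divr_ge0 ?sqr_ge0 ?ltW.
have -> : 2 * x * (Q n l + 2 * s n * b ^+ 2) = 2 * x * Q n l + 4 * x * s n * b ^+ 2.
  by ring.
by rewrite lerD2r.
Qed.

Lemma projection_le1 n l : 0 <= l -> normc (phi n l) <= 1.
Proof.
move=> l0; rewrite -(@ler_sqr _ _ 1) ?nnegrE ?normc_ge0// expr1n.
apply: (le_trans (projection_le_energy n l)); rewrite -ler_pdivlMl ?mulr_gt0// mulr1.
exact: energy_le.
Qed.

Lemma interp_coef0E n :
  interp_coef n 0 = \prod_(j < n) ((z + (s j)%:C) / (z - (s j)%:C)).
Proof.
by elim: n => [|n IH]; rewrite ?big_ord0// big_ord_recr interp_coef_lt// IH.
Qed.

(** A new coefficient is, up to a factor, the previous Laplace transform evaluated at minus the new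
    node, hence a product; later nodes only multiply it by further factors of the same form. The
    order of insertion thus disappears from the formula. *)
Lemma interp_coefSE n k : (k < n)%N ->
  interp_coef n k.+1 = - (2 * (s k)%:C / (z - (s k)%:C)) *
    \prod_(j < n) (if j == k :> nat then 1 else
      ((s k)%:C + (s j)%:C) / ((s k)%:C - (s j)%:C)).
Proof.
elim: n => // n IH; rewrite ltnS leq_eqVlt => /predU1P[->|kn]; last first.
  by rewrite interp_coef_lt// IH// big_ord_recr/= gtn_eqF// [RHS]mulrA.
rewrite interp_coef_last [in RHS]big_ord_recr/= eqxx mulr1.
rewrite [X in _ * X](_ : _ = - \sum_(i < n.+1) interp_coef n i / (- p n.+1 + p i)); last first.
  rewrite -sumrN; apply: eq_bigr => i _.
  by rewrite -mulrN -invrN opprD opprK.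
rewrite interp_laplaceE; last by move=> i i_n; rewrite addrC p_inj.
rewrite /pole mulrN mulNr mulrA addrC; congr (- (_ * _)).
apply: eq_bigr => -[j jn] _ /=; rewrite ltn_eqF//.
by rewrite -opprD -[X in _ / (_ + X)]opprK -opprD invrN mulrNN.
Qed.

(** Divided by its coefficient of e^{-z l}, [phi] becomes the approximation error, and the inverse
    modulus of that coefficient is the Blaschke product. In the bound on [b], 4 = 2 * 2: one 2 from
    (z + zb) / (s_k + zb), the other from 2 s_k / |z + s_k|. *)
Lemma exp_interpolation n : exists b : nat -> R[i],
  (forall k, (k < n)%N -> normc (b k) <=
     4 * \prod_(j < n) (if j == k :> nat then 1 else (s k + s j) / `|s k - s j|)) /\
  forall l, 0 <= l ->
    normc (cexp (- z * l%:C) - \sum_(k < n) b k * cexp (- (s k)%:C * l%:C)) <=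
    \prod_(j < n) (normc (z - (s j)%:C) / normc (z + (s j)%:C)).
Proof.
have zDs j : z + (s j)%:C != 0 := pD_neq0 0 j.+1.
have zBs j : z - (s j)%:C != 0 := p_inj (ltn0Sn j).
have c0 : interp_coef n 0 != 0.
  by rewrite interp_coef0E; apply/prodf_neq0 => j _; rewrite mulf_neq0// invr_eq0.
have normc_gt0 (w : R[i]) : w != 0 -> 0 < normc w.
  by move=> w0; rewrite lt_neqAle normc_ge0 andbT eq_sym; apply: contra_neq w0 => /eq0_normc.
have prodE : (normc (interp_coef n 0))^-1 =
    \prod_(j < n) (normc (z - (s j)%:C) / normc (z + (s j)%:C)).
  rewrite interp_coef0E (big_morph (@normc R) (@normcM R) (@normc1 R)) -prodfV.
  by apply: eq_bigr => j _; rewrite normcM normcV invfM invrK mulrC.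
exists (fun k => - (interp_coef n k.+1 * ((z + zb) / ((s k)%:C + zb)) / interp_coef n 0)).
split=> [k kn|l l0].
  have x0 : 0 < x by [].
  have sz : s k <= normc (z + (s k)%:C).
    apply: le_trans (Re_le_normc _); rewrite Re_add /= lerDr; exact: ltW.
  have leq1 j : normc (z - (s j)%:C) / normc (z + (s j)%:C) <= 1.
    rewrite ler_pdivrMr ?mul1r ?normc_gt0//.
    rewrite -ler_sqr ?nnegrE ?normc_ge0// !sqr_normc /sq.
    have xE : z = x +i* complex.Im z by rewrite /x; case: (z).
    rewrite xE /= subr0 addr0 lerD2r -subr_ge0.
    have -> : (x + s j) ^+ 2 - (x - s j) ^+ 2 = 4 * x * s j by ring.
    by rewrite ltW// !mulr_gt0.
  have w2 : normc ((z + zb) / ((s k)%:C + zb)) <= 2.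
    rewrite normcM normcV ler_pdivrMr ?normc_gt0//; last exact: (pzb_neq0 k.+1).
    have -> : z + zb = (2 * x)%:C.
      by rewrite /x; case: (z) => a b; apply/eqP; rewrite eq_complex /= subrr eqxx andbT; apply/eqP; ring.
    rewrite normc_real ger0_norm ?mulr_ge0 ?(ltW x0)// ler_pM2l//.
    apply: le_trans (Re_le_normc _); rewrite Re_add /=.
    by rewrite /x; case: (z) => a b /=; rewrite lerDr ltW.
  rewrite normcN [normc (_ / interp_coef n 0)]normcM normcV prodE.
  rewrite [normc (interp_coef _ _ * _)]normcM interp_coefSE// [normc (- _ * _)]normcM.
  rewrite (big_morph (@normc R) (@normcM R) (@normc1 R)).
  set P := \prod_(j < n) normc _.
  have PE : P = \prod_(j < n) (if j == k :> nat then 1 else (s k + s j) / `|s k - s j|).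
    apply: eq_bigr => j _; case: ifP => _; first by rewrite normc1.
    rewrite normcM normcV -rmorphD -rmorphB !normc_real ger0_norm//.
    by rewrite addr_ge0// ltW.
  have P0 : 0 <= P by apply: prodr_ge0 => j _; exact: normc_ge0.
  have -> : 2 * (s k)%:C = (2 * s k)%:C by rewrite rmorphM rmorph_nat.
  rewrite -PE normcN normcM normcV normc_real ger0_norm; last first.
    by rewrite mulr_ge0// ltW.
  (* The factor j = k of the Blaschke product cancels the denominator z - s_k of the coefficient, so
     the bound survives when z is close to a node. *)
  rewrite (bigD1 (Ordinal kn))//=.
  set S := \prod_(j < n | _) _.
  have S1 : S <= 1 by apply: prodr_ile1 => j _; rewrite leq1 divr_ge0 ?normc_ge0.
  have S0 : 0 <= S by apply: prodr_ge0 => j _; rewrite divr_ge0 ?normc_ge0.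
  move: (normc_gt0 _ (zBs k)) w2 sz => {leq1}.
  have := normc_ge0 ((z + zb) / ((s k)%:C + zb)).
  move: (normc ((z + zb) / _)) (normc (z - _)) => w d w0 d0 w2.
  have := normc_gt0 _ (zDs k); move: (normc (z + _)) (s_gt0 k) => e sk0 e0 se.
  have -> : 2 * s k / d * P * w * (d / e * S) = 2 * P * (s k / e * w * S).
    by field; rewrite !gt_eqF.
  have -> : 4 * P = 2 * P * (1 * 2 * 1) by ring.
  have se0 : 0 <= s k / e by rewrite divr_ge0 ?ltW.
  rewrite ler_wpM2l ?mulr_ge0//; apply: ler_pM => //; first exact: mulr_ge0.
  by apply: ler_pM => //; rewrite ler_pdivrMr ?mul1r.
rewrite -prodE (_ : _ - _ = phi n l / interp_coef n 0); last first.
  rewrite /phi big_ord_recl mulrDl divff ?(pzb_neq0 0)// mulr1.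
  rewrite mulrAC divff// mul1r -sumrN mulr_suml; congr (_ + _).
  apply: eq_bigr => k _; rewrite mulNr opprK /E /=.
  by rewrite mulrAC.
by rewrite normcM normcV ler_piMl ?invr_ge0 ?normc_ge0// projection_le1.
Qed.

End exponential_interpolation.

(** * Size of the coefficients for equally spaced nodes *)

Lemma bin_le_exp2 n k : ('C(n, k) <= 2 ^ n)%N.
Proof.
elim: n k => [|n IH] [|k]//; first by rewrite bin0 expn_gt0.
by rewrite binS expnS mul2n -addnn leq_add.
Qed.

Lemma prodn_rising k n : ((\prod_(j < n) (k + j).+1) * k`! = (k + n)`!)%N.
Proof.
elim: n => [|n IH]; first by rewrite big_ord0 mul1n addn0.
by rewrite big_ord_recr/= mulnAC IH addnS factS mulnC.
Qed.

(** The sum of the two truncated differences is |k - j|; the indices below k contribute k! and the m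
    indices above it m!. *)
Lemma prodn_dist k m :
  (\prod_(j < k.+1 + m) (if j == k :> nat then 1 else (k - j) + (j - k)) = k`! * m`!)%N.
Proof.
rewrite big_split_ord/= big_ord_recr/= eqxx muln1; congr (_ * _)%N.
  rewrite -[k`!]add0n -(prodn_rising 0) muln1 (reindex_inj rev_ord_inj)/=.
  by apply: eq_bigr => -[j jk] _ /=; rewrite ltn_eqF; lia.
elim: m => [|m IH]; first by rewrite big_ord0.
rewrite big_ord_recr/= {}IH factS mulnC gtn_eqF; last lia.
congr (_ * _)%N; lia.
Qed.

(** The factors are (k + j + 1) / |k - j|. With n = k + 1 + m the product is at most (k + n)! /
    (k!^2 m!) = n C(k + n, k) C(k + m, k), and the powers of 2 bounding the two binomials have
    exponents of sum at most 3 n. *)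
Lemma node_product_le (R : realType) n k : (k < n)%N ->
  \prod_(j < n) (if j == k :> nat then 1 else
    ((2 * k + 1)%:R + (2 * j + 1)%:R) / `|(2 * k + 1)%:R - (2 * j + 1)%:R|)
  <= (n * 8 ^ n)%:R :> R.
Proof.
move=> kn; have [m nE] : exists m, n = (k.+1 + m)%N by exists (n - k.+1)%N; lia.
set D := (\prod_(j < n) (if j == k :> nat then 1 else (k - j) + (j - k)))%N.
have DE : D = (k`! * m`!)%N by rewrite /D nE prodn_dist.
have D0 : (0 < D)%N by rewrite DE muln_gt0 !fact_gt0.
apply: (@le_trans _ _ ((\prod_(j < n) (k + j).+1)%:R / D%:R)).
  rewrite /D !natr_prod -prodfV -big_split/=.
  apply: ler_prod => j _; case: ifPn => jk.
    by rewrite ler01 invr1 mulr1 ler1n.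
  have -> : `|(2 * k + 1)%:R - (2 * j + 1)%:R| = 2 * (k - j + (j - k))%:R :> R.
    case: (ltngtP j k) jk => // jk _.
    - rewrite -natrB ?ger0_norm// -?natrM; first by congr _%:R; lia.
      lia.
    - rewrite distrC -natrB ?ger0_norm// -?natrM; first by congr _%:R; lia.
      lia.
  have -> : (2 * k + 1)%:R + (2 * j + 1)%:R = 2 * (k + j).+1%:R :> R.
    by rewrite -natrD -natrM; congr _%:R; lia.
  by rewrite -mulf_div divff ?pnatr_eq0// mul1r lexx andbT divr_ge0.
rewrite ler_pdivrMr ?ltr0n// -natrM ler_nat.
rewrite -(leq_pmul2r (fact_gt0 k)) prodn_rising DE.
have E1 := bin_fact (leq_addr n k); rewrite addKn in E1.
have E2 := bin_fact (leq_addr m k); rewrite addKn in E2.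
have B1 := bin_le_exp2 (k + n) k; have B2 := bin_le_exp2 (k + m) k.
rewrite -E1 {2 3}nE addSn factS -addSn -nE -E2.
have -> : (8 ^ n = 2 ^ (3 * n))%N by rewrite expnM.
have C12 : ('C(k + n, k) * 'C(k + m, k) <= 2 ^ (3 * n))%N.
  by rewrite (leq_trans (leq_mul B1 B2))// -expnD leq_exp2l//; lia.
have -> : ('C(k + n, k) * (k`! * (n * ('C(k + m, k) * (k`! * m`!)))) =
  ('C(k + n, k) * 'C(k + m, k)) * (n * (k`! * m`!) * k`!))%N by ring.
have -> : (n * 2 ^ (3 * n) * (k`! * m`!) * k`! =
  2 ^ (3 * n) * (n * (k`! * m`!) * k`!))%N by ring.
exact: leq_mul.
Qed.

Lemma exp_approximation (R : realType) (z : R[i]) (n : nat) :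
  0 < complex.Re z -> exists (b : nat -> R[i]) (s : nat -> R),
  [/\ forall k, (k < n)%N -> 0 < s k <= normc z,
      \sum_(k < n) normc (b k) <= 4 * expR (5 * n%:R) &
      forall l, 0 <= l ->
        normc (cexp (- z * l%:C) - \sum_(k < n) b k * cexp (- (s k)%:C * l%:C))
        <= expR (- (complex.Re z / normc z * n%:R / 8))].
Proof.
move=> z0; set N := normc z; set x := complex.Re z in z0 *.
have N0 : 0 < N by rewrite (lt_le_trans z0)// Re_le_normc.
(* Odd over even: no node equals |z|, so z differs from all nodes even when it is real, and those
   with k < n stay below |z|. *)
pose a k : R := (2 * k + 1)%:R / (2 * n.+1)%:R.
pose s k := N * a k.
have a0 k : 0 < a k by rewrite divr_gt0 ?ltr0n// addn1.
have s0 k : 0 < s k by rewrite mulr_gt0.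
have n0 : ((2 * n.+1)%:R : R) != 0 by rewrite pnatr_eq0.
have s_inj : injective s.
  move=> i j /(mulfI (lt0r_neq0 N0)) /(mulIf (invr_neq0 n0)) /eqP.
  by rewrite eqr_nat => /eqP; lia.
have zs k : z != (s k)%:C.
  apply/eqP => zE; have : N = s k by rewrite /N zE normc_real gtr0_norm.
  rewrite /s /a mulrA => NE.
  have : N * (2 * n.+1)%:R = N * (2 * k + 1)%:R by rewrite {1}NE divfK.
  by move=> /(mulfI (lt0r_neq0 N0)) /eqP; rewrite eqr_nat => /eqP; lia.
have [b [bb bE]] := exp_interpolation z0 s0 s_inj zs n.
exists b, s; split => [k kn||l /bE {}bE].
- rewrite s0 /s ler_piMr ?(ltW N0)// /a ler_pdivrMr ?ltr0n// mul1r ler_nat; lia.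
- apply: (@le_trans _ _ (\sum_(k < n) 4 * (n * 8 ^ n)%:R)).
    apply: ler_sum => k _; apply: (le_trans (bb _ (ltn_ord k))).
    rewrite ler_pM2l//; apply: le_trans (node_product_le R (ltn_ord k)).
    rewrite le_eqVlt; apply/orP; left; apply/eqP; apply: eq_bigr => j _.
    case: ifPn => // jk.
    rewrite /s -mulrDr -mulrBr normrM (gtr0_norm N0) -mulf_div divff ?gt_eqF// mul1r.
    rewrite /a -mulrDl -mulrBl normrM (@gtr0_norm _ (_^-1)) ?invr_gt0 ?ltr0n//.
    by rewrite -mulf_div divff ?mulr1// invr_eq0.
  rewrite sumr_const card_ord -[4 * _ *+ n]mulr_natr -mulrA ler_pM2l// -natrM.
  apply: (@le_trans _ _ (2 ^+ (5 * n))).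
    rewrite -natrX ler_nat (_ : 5 * n = n + 3 * n + n)%N; last lia.
    by rewrite expnD [(2 ^ (n + _))%N]expnD expnM !leq_mul// ltnW// ltn_expl.
  have e2 : 2 <= expR (1 : R) by rewrite (le_trans _ (expR_ge1Dx _)).
  have -> : 5 * n%:R = (5 * n)%:R * 1 :> R by rewrite natrM mulr1.
  rewrite expRM_natl.
  by rewrite lerXn2r ?nnegrE ?expR_ge0.
apply: (le_trans bE).
have sumaE : \sum_(j < n) a j = (n * n)%:R / (2 * n.+1)%:R.
  rewrite -mulr_suml -natr_sum; congr (_%:R / _).
  elim: (n) => [|k IH]; first by rewrite big_ord0.
  by rewrite big_ord_recr/= IH; lia.
(* The square of a Blaschke factor is at most 1 - (x / N) a_j, hence at most exp (- (x / N) a_j).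
   The sum of the a_j is n^2 / (2 (n + 1)) >= n / 4 for n >= 1, and the square root turns 4 into
   8. *)
apply: (@le_trans _ _ (\prod_(j < n) expR (- (x / N * (a j / 2))))).
  apply: ler_prod => j _; rewrite divr_ge0 ?normc_ge0//=.
  have a1 : a j <= 1.
    by rewrite ler_pdivrMr ?ltr0n// mul1r ler_nat; have := ltn_ord j; lia.
  have xN : x <= N by exact: Re_le_normc.
  have zsj : 0 < normc (z + (s j)%:C).
    apply: lt_le_trans (Re_le_normc _).
    by rewrite (_ : complex.Re _ = x + s j) ?addr_gt0// /x; case: (z).
  rewrite -ler_sqr ?nnegrE ?divr_ge0 ?normc_ge0 ?expR_ge0//.
  rewrite [leRHS]expr2 -expRD.
  have -> : - (x / N * (a j / 2)) + - (x / N * (a j / 2)) = - (x / N * a j).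
    by field; rewrite gt_eqF.
  apply: le_trans (expR_ge1Dx _); rewrite exprMn exprVn.
  rewrite ler_pdivrMr ?exprn_gt0//.
  have N2 : N ^+ 2 = x ^+ 2 + complex.Im z ^+ 2.
    by rewrite sqr_normc.
  rewrite !sqr_normc.
  have -> : complex.Re (z - (s j)%:C) = x - s j by rewrite /x; case: (z).
  have -> : complex.Im (z - (s j)%:C) = complex.Im z by case: (z) => ? ? /=; rewrite subr0.
  have -> : complex.Re (z + (s j)%:C) = x + s j by rewrite /x; case: (z).
  have -> : complex.Im (z + (s j)%:C) = complex.Im z by case: (z) => ? ? /=; rewrite addr0.
  rewrite -subr_ge0.
  have -> : (1 + - (x / N * a j)) * ((x + s j) ^+ 2 + complex.Im z ^+ 2) -
      ((x - s j) ^+ 2 + complex.Im z ^+ 2) =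
      x * N * a j * (3 - 2 * (x / N) * a j - a j ^+ 2).
    have -> : complex.Im z ^+ 2 = N ^+ 2 - x ^+ 2 by rewrite N2 addrC addKr.
    by rewrite /s; field; rewrite gt_eqF.
  have xN1 : x / N <= 1 by rewrite ler_pdivrMr// mul1r.
  have xN0 : 0 <= x / N by rewrite divr_ge0 ?ltW.
  have := a0 j; move: (a j) (x / N) a1 xN1 xN0 => c w c1 w1 w0 c0.
  rewrite mulr_ge0// ?mulr_ge0 ?(ltW z0) ?(ltW N0) ?(ltW c0)//.
  have : w * c <= 1 by rewrite -[1]mulr1 ler_pM// ltW.
  have : c ^+ 2 <= 1 by rewrite expr_le1// ltW.
  lra.
rewrite -expR_sum ler_expR sumrN lerN2 -mulr_sumr -mulrA ler_wpM2l//.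
  by rewrite divr_ge0 ?ltW.
rewrite -mulr_suml sumaE.
case: n {b bb bE sumaE a s a0 s0 n0 s_inj zs} => [|n]; first by rewrite !mul0r.
rewrite natrM natrM -(natr1 n.+1); set t : R := n.+1%:R.
have t1 : 1 <= t by rewrite ler1n.
rewrite -subr_ge0.
have -> : t * t / (2 * (t + 1)) / 2 - t / 8 = t * (t - 1) / (8 * (t + 1)).
  by field; rewrite gt_eqF// ltr_wpDl// (le_trans _ t1).
by rewrite divr_ge0 ?mulr_ge0 ?subr_ge0 ?addr_ge0// (le_trans _ t1).
Qed.

(** * Real times *)

Section doubling.
Context (R : realType) (d : measure_display) (X : borelMetricType R d).
Variable mu : {measure set X -> \bar R}.
Implicit Types (x y : X) (r s D : R).

Lemma mem_ball x r y : ball x r y <-> mdist x y < r.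
Proof. by rewrite ballEmdist. Qed.

Lemma measurable_ball_borel x r : measurable (ball x r).
Proof.
rewrite measurable_borelE; apply: sub_sigma_algebra => /=.
rewrite openE => y /mem_ball xy; apply/nbhs_ballP.
exists (r - mdist x y); first by rewrite /= subr_gt0.
move=> w /mem_ball yw; apply/mem_ball; apply: (le_lt_trans (metric_triangle x y w)).
by rewrite -ltrBDl.
Qed.

Variable K : R.
Hypothesis K0 : 0 < K.
Hypothesis mu_fin : forall x r, 0 < r -> (mu (ball x r) < +oo)%E.
Hypothesis mu_doubling : forall x r, 0 < r ->
  (mu (ball x (2 * r)) <= K%:E * mu (ball x r))%E.

Lemma doubling_iter x r l : 0 < r ->
  (mu (ball x (2 ^+ l * r)) <= (K ^+ l)%:E * mu (ball x r))%E.
Proof.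
move=> r0; elim: l => [|l IH]; first by rewrite !expr0 mul1r mul1e.
rewrite !exprS -mulrA; apply: (le_trans (mu_doubling _ _)).
  by rewrite mulr_gt0// exprn_gt0.
by rewrite EFinM -muleA lee_pmul2l ?lte_fin.
Qed.

Lemma measure_separated s (xs : seq X) :
  pairwise (fun a b => s <= mdist a b) xs ->
  (\sum_(y <- xs) mu (ball y (s / 2)) =
   mu (\big[setU/set0]_(y <- xs) ball y (s / 2)))%E.
Proof.
elim: xs => [|y xs IH]; first by rewrite !big_nil measure0.
rewrite /= => /andP[ysep xsep]; rewrite !big_cons IH// measureU//.
- exact: measurable_ball_borel.
- apply: bigsetU_measurable => w _; exact: measurable_ball_borel.
rewrite -subset0 => w [/mem_ball yw]; rewrite -bigcup_seq => -[v /= vxs /mem_ball vw].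
have := allP ysep _ vxs; rewrite leNgt => /negP; apply.
apply: (le_lt_trans (metric_triangle y w v)).
by rewrite [ltRHS]splitr ltrD// metric_sym.
Qed.

(** The balls of radius s / 2 are disjoint and lie in B(x, 2 D), while B(x, 2 D) lies in B(y, 3 D),
    so each of them carries at least the fraction K^-l of its measure. That measure is then
    cancelled, being finite and positive. *)
Lemma separated_size x D s l (xs : seq X) : 0 < D -> 0 < s -> s <= 2 * D ->
  3 * D <= 2 ^+ l * (s / 2) -> (0 < mu (ball x (2 * D)))%E ->
  pairwise (fun a b => s <= mdist a b) xs ->
  {in xs, forall y, mdist x y < D} -> (size xs)%:R <= K ^+ l.
Proof.
move=> D0 s0 sD Dl mu0 xsep xsD.
have V : mu (ball x (2 * D)) \is a fin_num.
  by rewrite ge0_fin_numE// mu_fin// mulr_gt0.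
have s2 : 0 < s / 2 by rewrite divr_gt0.
rewrite -lee_fin -(@lee_pmul2r _ (mu (ball x (2 * D))))//.
have -> : ((size xs)%:R%:E * mu (ball x (2 * D)) = \sum_(y <- xs) mu (ball x (2 * D)))%E.
  elim: (xs) => [|y ys IH]; first by rewrite mul0e big_nil.
  rewrite big_cons -IH /= -addn1 addnC natrD EFinD ge0_muleDl ?mul1e ?lee_fin//.
apply: (@le_trans _ _ (\sum_(y <- xs) (K ^+ l)%:E * mu (ball y (s / 2)))%E).
  rewrite big_seq [leRHS]big_seq; apply: lee_sum => y yxs.
  apply: le_trans (doubling_iter y l s2).
  apply: le_measure; rewrite ?inE; try exact: measurable_ball_borel.
  move=> w /mem_ball xw; apply/mem_ball; apply: lt_le_trans Dl.
  apply: (le_lt_trans (metric_triangle y x w)); rewrite metric_sym.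
  have := xsD _ yxs; move: xw; lra.
rewrite -ge0_sume_distrr// measure_separated// lee_pmul2l ?lte_fin ?exprn_gt0//.
apply: le_measure; rewrite ?inE; try exact: measurable_ball_borel.
  apply: bigsetU_measurable => w _; exact: measurable_ball_borel.
rewrite -bigcup_seq => w [y /= yxs /mem_ball yw]; apply/mem_ball.
apply: (le_lt_trans (metric_triangle x y w)).
have := xsD _ yxs; lra.
Qed.

(** A separated family of maximal size covers, as an uncovered point could be added to it; the
    packing bound makes the maximum exist. *)
Lemma ball_cover x D s l : 0 < D -> 0 < s -> s <= 2 * D ->
  3 * D <= 2 ^+ l * (s / 2) -> (0 < mu (ball x (2 * D)))%E ->
  exists2 xs : seq X, (size xs)%:R <= K ^+ l &
    forall y, mdist x y < D -> exists2 c, c \in xs & mdist c y < s.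
Proof.
move=> D0 s0 sD Dl mu0.
pose P n := `[< exists xs : seq X, [/\ size xs = n,
  pairwise (fun a b => s <= mdist a b) xs & {in xs, forall y, mdist x y < D}] >].
have Kl := fun xs => @separated_size x D s l xs D0 s0 sD Dl mu0.
have P0 : exists n, P n by exists 0%N; apply/asboolP; exists [::].
have Pb n : P n -> (n <= Num.truncn (K ^+ l))%N.
  move=> /asboolP[xs [<- xsep xsD]].
  rewrite truncn_ge_nat; first exact: Kl.
  exact/exprn_ge0/ltW.
case: (ex_maxnP P0 Pb) => n /asboolP[xs [sxs xsep xsD]] nmax.
exists xs; first exact: Kl.
move=> y xy; apply: contrapT => ny.
have : P n.+1.
  apply/asboolP; exists (y :: xs); split => //=; first by rewrite sxs.
    rewrite xsep andbT; apply/allP => c cxs; rewrite leNgt; apply/negP => yc.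
    by apply: ny; exists c; rewrite // metric_sym.
  by move=> w; rewrite inE => /predU1P[->|/xsD].
by move=> /nmax; rewrite ltnn.
Qed.

End doubling.

(** * From estimates on pairs of balls to estimates on pairs of sets *)

Section off_diagonal.
Context (R : realType) (d : measure_display) (X : borelMetricType R d).
Variable mu : {measure set X -> \bar R}.
Local Notation H := (L2 mu).
Implicit Types (x y : X) (r s D : R) (A E U : set X) (u v : H) (xs : seq X).

Lemma restrictL2_set0 u : restrictL2 set0 u = 0.
Proof. by rewrite restrictL2_null. Qed.

(** U is cut into disjoint pieces, one per ball; a piece need not be all of U in its ball, hence the
    quantification over A. The subadditive N is abstract because the lemma serves twice: for the
    argument of an operator and for its value. *)
Lemma restrict_cover (N : H -> R) u s M xs U :
  N 0 <= 0 -> (forall v w, N (v + w) <= N v + N w) -> measurable U ->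
  (forall y, U y -> exists2 c, c \in xs & ball c s y) ->
  (forall c A, c \in xs -> measurable A -> A `<=` U `&` ball c s ->
     N (restrictL2 A u) <= M) ->
  N (restrictL2 U u) <= (size xs)%:R * M.
Proof.
move=> N0 ND; elim: xs U => [|c xs IH] U mU Uxs UM.
  have -> : U = set0 by rewrite -subset0 => y /Uxs[].
  by rewrite restrictL2_set0 mul0r.
have mb := @measurable_ball_borel R d X c s.
have -> : U = (U `&` ball c s) `|` (U `\` ball c s).
  by rewrite setUC setDE -setIUr setUCl setIT.
rewrite restrictL2U; last 3 first.
- exact: measurableI.
- exact: measurableD.
- by rewrite setDE setIACA setICr setI0.
apply: (le_trans (ND _ _)); rewrite /= -natr1 mulrDl mul1r addrC lerD//.
  apply: IH => [|y [Uy cy]|c' A c'xs mA AU].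
  - exact: measurableD.
  - have [c' + c'y] := Uxs _ Uy; rewrite inE => /predU1P[c'E|]; last by exists c'.
    by rewrite c'E in c'y.
  - apply: (UM c') => //; first by rewrite inE c'xs orbT.
    by apply: (subset_trans AU) => y [[]].
by apply: (UM c) => //; [rewrite inE eqxx|exact: measurableI].
Qed.

Lemma opnorm_le (T : H -> H) u M :
  (opnorm T <= M%:E)%E -> normL2 u <= 1 -> normL2 (T u) <= M.
Proof.
move=> TM u1; rewrite -lee_fin; apply: le_trans TM.
by apply: ereal_sup_ubound; exists u.
Qed.

Lemma cover_bound (T : H -> H) s M xs E U u :
  linear T -> 0 <= M -> measurable E -> measurable U ->
  (forall y, (E `|` U) y -> exists2 c, c \in xs & ball c s y) ->
  (forall a b, (exists2 y, E y & ball a s y) -> (exists2 y, U y & ball b s y) ->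
     (opnorm (restrictL2 (ball a s) \o T \o restrictL2 (ball b s))%R <= M%:E)%E) ->
  normL2 u <= 1 ->
  normL2 (restrictL2 E (T (restrictL2 U u))) <= (size xs)%:R * ((size xs)%:R * M).
Proof.
move=> Tlin M0 mE mU cov TM u1.
have T0 : T 0 = 0.
  by have := Tlin (-1) 0 0; rewrite scaler0 addr0 scaleN1r addNr.
have TD v w : T (v + w) = T v + T w by have := Tlin 1 v w; rewrite !scale1r.
have n0 := normL2_0 mu.
have mb c := @measurable_ball_borel R d X c s.
apply: (@restrict_cover (fun v => normL2 (restrictL2 E (T v))) u s _ xs U) => //.
- by rewrite T0 restrictL2_0// n0.
- by move=> v w; rewrite TD restrictL2D// normL2D.
- by move=> y Uy; apply: cov; right.
move=> b A bxs mA AU; apply: (@restrict_cover (@normL2 _ _ _ mu) _ s) => //.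
- by rewrite n0.
- exact: normL2D.
- by move=> y Ey; apply: cov; left.
move=> a A' axs mA' AE.
(* Nonempty pieces provide the points of E and U that [TM] requires: only balls meeting these sets
   have to be far apart. *)
have [->|/set0P[y' A'y]] := eqVneq A' set0; first by rewrite restrictL2_set0 n0.
have [->|/set0P[y Ay]] := eqVneq A set0.
  by rewrite restrictL2_set0 T0 restrictL2_0// n0.
have [Ey' ay'] := AE _ A'y; have [Uy byy] := AU _ Ay.
have -> : A' = A' `&` ball a s by apply/esym/setIidPl => w /AE[].
have -> : A = ball b s `&` A by apply/esym/setIidPr => w /AU[].
rewrite -restrictL2I// -restrictL2I//; apply: (le_trans (normL2_restrict _ mA')).
apply: (opnorm_le (TM a b _ _)); [by exists y'|by exists y|].
exact: le_trans (normL2_restrict _ mA) u1.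
Qed.

End off_diagonal.

Lemma sqrn_le_exp2 n : (n ^ 2 <= 2 * 2 ^ n)%N.
Proof.
case: n => [|[|[|n]]]//; elim: n => // n IH.
rewrite [(2 ^ n.+4)%N]expnS; move: IH; move: (2 ^ n.+3)%N => w.
rewrite -!mulnn; nia.
Qed.

Lemma exists_exp2_bracket (R : realType) (y : R) : 1 <= y ->
  exists l, y <= 2 ^+ l <= 2 * y.
Proof.
move=> y1.
have ex : exists l, y <= 2 ^+ l.
  exists (Num.truncn y).+1; apply: (le_trans (ltW (truncnS_gt y))).
  by rewrite -natrX ler_nat ltnW// ltn_expl.
case: (ex_minnP ex) => -[|l] yl lmin; first by exists 0%N; rewrite yl expr0 mulr_ege1// ler1n.
exists l.+1; rewrite yl exprS ler_pM2l//= leNgt; apply/negP => /ltW /lmin.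
by rewrite ltnn.
Qed.

(** Here 2^l is of order y, so the left side is a power of y. Since l^2 <= 2 * 2^l <= 24 y, taking e
    = c / 24 reduces the claim to k l <= k^2 / e + e l^2. *)
Lemma exp2_growth_absorb (R : realType) (k c : R) : 0 <= k -> 0 < c ->
  exists2 B : R, 0 < B & forall (y : R) (l : nat), 2 ^+ l <= 12 * y ->
    expR (k * l%:R) <= B * expR (c * y).
Proof.
move=> k0 c0; set e := c / 24.
have e0 : 0 < e by rewrite divr_gt0.
exists (expR (k ^+ 2 / e)) => [|y l ly]; first exact: expR_gt0.
rewrite -expRD ler_expR.
have l2 : l%:R ^+ 2 <= 24 * y.
  have := sqrn_le_exp2 l; rewrite -(ler_nat R) natrX natrM natrX => /le_trans; apply.
  by move: ly; move: (2 ^+ l) => w; lra.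
have -> : c * y = e * (24 * y) by rewrite /e; field.
apply: (@le_trans _ _ (k ^+ 2 / e + e * l%:R ^+ 2)); last first.
  by rewrite lerD2l ler_pM2l.
rewrite -subr_ge0.
have -> : k ^+ 2 / e + e * l%:R ^+ 2 - k * l%:R =
    ((k - e * l%:R / 2) ^+ 2 + 3 / 4 * (e * l%:R) ^+ 2) / e.
  by field; rewrite gt_eqF.
by rewrite divr_ge0 ?(ltW e0)// addr_ge0 ?sqr_ge0// mulr_ge0 ?sqr_ge0.
Qed.

Section off_diagonal_bound.
Context (R : realType) (d : measure_display) (X : borelMetricType R d).
Variable mu : {measure set X -> \bar R}.
Local Notation H := (L2 mu).

Lemma off_diagonal_bound (C c p : R) :
  homogeneous_type mu -> 0 < C -> 0 < c -> 1 <= p ->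
  exists C1 c1 : R, [/\ 0 < C1, 0 < c1 &
  forall (T : H -> H) (s : R), linear T -> (forall u, normL2 (T u) <= normL2 u) ->
    0 < s ->
    (forall a b : X,
      (opnorm (restrictL2 (ball a s) \o T \o restrictL2 (ball b s))%R <=
       (C * expR (- c * (mdist a b / s) `^ p))%:E)%E) ->
    forall (x : X) (D : R) (E U : set X) (u : H), 0 < D ->
      measurable E -> measurable U -> E `<=` ball x (D / 4) ->
      U `<=` ball x D `\` ball x (D / 2) -> normL2 u <= 1 ->
      normL2 (restrictL2 E (T (restrictL2 U u))) <= C1 * expR (- c1 * (D / s) `^ p)].
Proof.
move=> [mu_fin [K0 K0_gt0 mu_doub]] C0 c0 p1.
have p0 : 0 <= p by exact: le_trans p1.
(* Makes [ln K] nonnegative, as the absorption lemma requires. *)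
pose K := Num.max K0 1.
have K_gt0 : 0 < K by rewrite lt_max K0_gt0.
have mu_doubling (x : X) (r : R) : 0 < r -> (mu (ball x (2 * r)) <= K%:E * mu (ball x r))%E.
  move=> r0; apply: (le_trans (mu_doub x r r0)).
  by rewrite lee_wpmul2r// lee_fin le_max lexx.
have k0 : 0 <= ln K by rewrite ln_ge0// le_max lexx orbT.
have kE : K = expR (ln K) by rewrite lnK// posrE.
(* The number of covering balls is polynomial in D / s, so it is absorbed by
   half of the exponent. *)
have [B B0 BE] := @exp2_growth_absorb R (2 * ln K) (c / 16) (mulr_ge0 (ltW (ltr0Sn _ 1)) k0) (divr_gt0 c0 (ltr0Sn _ 15)).
(* The 8 is a geometric loss: points of E and U are at least D / 4 apart, and passing to the centres
   of their balls costs 2 s < D / 8 once D > 16 s. *)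
pose c1 := c / 2 * 8^-1 `^ p.
have c10 : 0 < c1 by rewrite mulr_gt0 ?divr_gt0// powR_gt0 invr_gt0.
exists (B * C + expR (c1 * 16 `^ p)), c1; split => //.
  by rewrite addr_gt0 ?mulr_gt0// expR_gt0.
move=> T s Tlin Tle s0 TDG x D E U u D0 mE mU ED UD u1.
set y := D / s.
have y0 : 0 < y by rewrite divr_gt0.
have le1 : normL2 (restrictL2 E (T (restrictL2 U u))) <= 1.
  apply: (le_trans (normL2_restrict _ mE)); apply: (le_trans (Tle _)).
  exact: (le_trans (normL2_restrict _ mU)).
have [y16|y16] := leP y 16.
  apply: (le_trans le1).
  apply: (@le_trans _ _ (expR (c1 * 16 `^ p) * expR (- c1 * y `^ p))).
    rewrite -expRD -[leLHS]expR0 ler_expR mulNr subr_ge0 ler_pM2l//.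
    by apply: ge0_ler_powR; rewrite ?nnegrE ?(ltW y0).
  rewrite ler_pM2r ?expR_gt0// lerDr mulr_ge0//; exact: ltW.
(* Packing needs a ball of positive measure; in a null ball the restriction to U is 0. *)
have [mu0|mu0] := leP (mu (ball x (2 * D))) 0%E.
  have U0 : mu U = 0%E.
    apply/eqP; rewrite eq_le measure_ge0 andbT; apply: le_trans mu0.
    apply: le_measure; rewrite ?inE//; first exact: measurable_ball_borel.
    move=> w /UD[/mem_ball xw _]; apply/mem_ball; apply: (lt_trans xw).
    by rewrite ltr_pMl// ltr1n.
  have T0 : T 0 = 0.
    by have := Tlin (-1) 0 0; rewrite scaler0 addr0 scaleN1r addNr.
  rewrite (restrictL2_null u mU U0) T0 restrictL2_0// normL2_0.
  by rewrite mulr_ge0 ?expR_ge0// addr_ge0 ?mulr_ge0 ?expR_ge0 ?(ltW B0) ?(ltW C0).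
(* The covering condition 3 D <= 2^l s / 2 reads 6 y <= 2^l. *)
have y6 : 1 <= 6 * y by move: y16; lra.
have [l /andP[yl ly]] := exists_exp2_bracket y6.
have DE : D = y * s by rewrite /y divfK// gt_eqF.
have [||xs xsK xsD] := @ball_cover R d X mu K K_gt0 mu_fin mu_doubling x D s l D0 s0 _ _ mu0.
- by rewrite DE; nra.
- by rewrite DE; nra.
(* Since p >= 1, the linear growth c y / 16 from counting is at most half of c (y / 8)^p. *)
have yp : y / 8 <= (y / 8) `^ p.
  by apply: le1r_powR => //; move: y16; lra.
apply: (@le_trans _ _ ((size xs)%:R * ((size xs)%:R * (C * expR (- c * (y / 8) `^ p))))).
  apply: (@cover_bound R d X mu T s _ xs E U u Tlin _ mE mU _ _ u1).
  - by rewrite mulr_ge0 ?expR_ge0 ?(ltW C0).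
  - move=> w EUw; suff /xsD[a axs aw] : mdist x w < D by exists a => //; exact/mem_ball.
    case: EUw => [/ED/mem_ball|/UD[/mem_ball]//]; lra.
  move=> a b [w1 /ED/mem_ball Ew1 /mem_ball aw1] [w2 /UD[_ Uw2] /mem_ball bw2].
  apply: (le_trans (TDG a b)); rewrite lee_fin ler_pM2l// ler_expR.
  rewrite !mulNr lerN2 ler_pM2l//; apply: ge0_ler_powR => //.
  - by rewrite nnegrE divr_ge0 ?(ltW y0).
  - by rewrite nnegrE divr_ge0 ?mdist_ge0 ?(ltW s0).
  rewrite ler_pdivlMr// mulrAC -DE.
  have xw2 : D / 2 <= mdist x w2 by rewrite leNgt; apply/negP => /mem_ball.
  have := metric_triangle x w1 w2; have := metric_triangle w1 a w2.
  have := metric_triangle a b w2; rewrite (metric_sym w1 a).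
  have : 16 * s < D by rewrite DE ltr_pM2r.
  lra.
apply: (@le_trans _ _ (B * C * expR (- c1 * y `^ p))); last first.
  by rewrite ler_pM2r ?expR_gt0// lerDl expR_ge0.
rewrite mulrA.
have -> : - c1 * y `^ p = - (c / 2) * (y / 8) `^ p.
  by rewrite powRM ?(ltW y0)// /c1; ring.
apply: (@le_trans _ _ (B * expR (c / 16 * y) * (C * expR (- c * (y / 8) `^ p)))).
  rewrite ler_wpM2r ?mulr_ge0 ?expR_ge0 ?(ltW C0)//.
  apply: (@le_trans _ _ (expR (2 * ln K * l%:R))); last first.
    by apply: BE; move: ly; move: (2 ^+ l) => w; lra.
  have -> : expR (2 * ln K * l%:R) = K ^+ l * K ^+ l.
    by rewrite [in RHS]kE -!expRM_natl -expRD; congr expR; ring.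
  by rewrite ler_pM.
have -> : B * expR (c / 16 * y) * (C * expR (- c * (y / 8) `^ p)) =
    B * C * (expR (c / 16 * y) * expR (- c * (y / 8) `^ p)) by ring.
rewrite ler_pM2l ?mulr_gt0// -expRD ler_expR.
move: yp; move: ((y / 8) `^ p) => q; move: y0 => _; nra.
Qed.

End off_diagonal_bound.

(** * Complex times *)

Section functional_calculus.
Context (R : realType).
Implicit Types (f g : R -> R[i]) (w a : R[i]).

Lemma bounded_borelD f g : bounded_borel f -> bounded_borel g ->
  bounded_borel (fun l => f l + g l).
Proof.
move=> [[fr fi] [M fM]] [[gr gi] [N gN]]; split; first split.
- rewrite (_ : _ \o _ = (@complex.Re R \o f) \+ (@complex.Re R \o g)).
    exact: measurable_funD.
  by apply/funext => l /=; case: (f l) (g l) => ? ? [].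
- rewrite (_ : _ \o _ = (@complex.Im R \o f) \+ (@complex.Im R \o g)).
    exact: measurable_funD.
  by apply/funext => l /=; case: (f l) (g l) => ? ? [].
exists (M + N) => l l0; apply: (le_trans (le_normcD _ _)).
by rewrite lerD ?fM ?gN.
Qed.

Lemma bounded_borelZ a f : bounded_borel f -> bounded_borel (fun l => a * f l).
Proof.
case: a => b c [[fr fi] [M fM]]; split; first split.
- rewrite (_ : _ \o _ = (fun l => b * complex.Re (f l) - c * complex.Im (f l))).
    by apply: measurable_funB; apply: measurable_funM.
  by apply/funext => l /=; case: (f l).
- rewrite (_ : _ \o _ = (fun l => b * complex.Im (f l) + c * complex.Re (f l))).
    by apply: measurable_funD; apply: measurable_funM.
  by apply/funext => l /=; case: (f l).
exists (normc (b +i* c) * M) => l l0.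
by rewrite normcM ler_wpM2l ?normc_ge0// fM.
Qed.

Lemma bounded_borel_sum n (b : nat -> R[i]) (f : nat -> R -> R[i]) :
  (forall k, (k < n)%N -> bounded_borel (f k)) ->
  bounded_borel (fun l => \sum_(k < n) b k * f k l).
Proof.
elim: n => [|n IH] bf.
  under eq_fun => l do rewrite big_ord0.
  split; first by split; exact: measurable_cst.
  by exists 0 => l _; rewrite normc0.
under eq_fun => l do rewrite big_ord_recr/=.
apply: bounded_borelD; first by apply: IH => k kn; apply: bf; exact: ltnW.
exact/bounded_borelZ/bf.
Qed.

Lemma normc_cexp w : normc (cexp w) = expR (complex.Re w).
Proof.
apply/eqP; rewrite -(eqrXn2 (n := 2))// ?normc_ge0 ?expR_ge0// sqr_normc/=.
by rewrite !exprMn -mulrDr cos2Dsin2 mulr1.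
Qed.

Lemma bounded_by_cexp w : complex.Re w <= 0 ->
  bounded_by 1 (fun l : R => cexp (w * l%:C)).
Proof.
move=> w0 l l0; rewrite normc_cexp -expR0 ler_expR mulrC Re_realM.
exact: mulr_ge0_le0.
Qed.

Lemma bounded_borel_cexp w : complex.Re w <= 0 ->
  bounded_borel (fun l : R => cexp (w * l%:C)).
Proof.
move=> w0; split; last by exists 1; exact: bounded_by_cexp.
have ml (a : R) : measurable_fun (`[0, +oo[ : set (measurableTypeR R)) (fun l : R => a * l).
  exact: measurable_funM.
split.
- rewrite (_ : _ \o _ = (fun l => expR (complex.Re w * l) * cos (complex.Im w * l))).
    apply: measurable_funM.
      by apply: measurableT_comp => //; exact: measurable_expR.
    apply: measurableT_comp => //.
    by apply: continuous_measurable_fun => t; exact: continuous_cos.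
  by apply/funext => l; exact: (congr1 (@complex.Re R) (cexp_realM w l)).
- rewrite (_ : _ \o _ = (fun l => expR (complex.Re w * l) * sin (complex.Im w * l))).
    apply: measurable_funM.
      by apply: measurableT_comp => //; exact: measurable_expR.
    apply: measurableT_comp => //.
    by apply: continuous_measurable_fun => t; exact: continuous_sin.
  by apply/funext => l; exact: (congr1 (@complex.Im R) (cexp_realM w l)).
Qed.

Context (d : measure_display) (X : measurableType d).
Variables (mu : {measure set X -> \bar R}) (L : unbounded_op mu).
Variable Phi : (R -> R[i]) -> L2 mu -> L2 mu.
Hypothesis calc : spectral_calculus L Phi.

Lemma calculus_sum n (b : nat -> R[i]) (f : nat -> R -> R[i]) u :
  (forall k, (k < n)%N -> bounded_borel (f k)) ->
  Phi (fun l => \sum_(k < n) b k * f k l) u = \sum_(k < n) b k *: Phi (f k) u.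
Proof.
elim: n => [|n IH] bf.
  rewrite big_ord0 (_ : (fun l => _) = (fun l : R => 0 * cexp (0 * l%:C))).
    by rewrite (calculusZ calc) ?scale0r//; exact: bounded_borel_cexp.
  by apply/funext => l; rewrite big_ord0 mul0r.
rewrite big_ord_recr/= -IH; last by move=> k kn; apply: bf; exact: ltnW.
rewrite -(calculusZ calc); last exact: bf.
rewrite -(calculusD calc).
- by congr Phi; apply/funext => l; rewrite big_ord_recr.
- by apply: bounded_borel_sum => k kn; apply: bf; exact: ltnW.
- exact/bounded_borelZ/bf.
Qed.

End functional_calculus.

(** The exponent m / (m - 1) is conjugate to m: a factor w^(1 - 1/m) inside the power comes out as w
    and cancels the division by w. *)
Lemma powR_rescale (R : realType) (rho w D m : R) :
  0 < rho -> 0 < w -> 0 <= D -> 1 < m ->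
  (D / (w / rho) `^ m^-1) `^ (m / (m - 1)) / w =
  (rho `^ m^-1 * D / w) `^ (m / (m - 1)).
Proof.
move=> rho0 w0 D0 m1; set p := m / (m - 1).
have m0 : 0 < m by exact: lt_trans m1.
have wm0 : 0 < w `^ m^-1 by rewrite powR_gt0.
have rm0 : 0 < rho `^ m^-1 by rewrite powR_gt0.
have -> : D / (w / rho) `^ m^-1 = (rho `^ m^-1 * D / w) * (w `^ (1 - m^-1)).
  have -> : w `^ (1 - m^-1) = w / w `^ m^-1.
    rewrite powRD; last by rewrite (gt_eqF w0) implybT.
    by rewrite powRN powRr1// ltW.
  rewrite powRM ?invr_ge0 ?(ltW w0) ?(ltW rho0)//.
  have -> : rho^-1 `^ m^-1 = (rho `^ m^-1)^-1.
    by rewrite -powR_inv1 ?(ltW rho0)// -powRrM mulN1r powRN.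
  by field; rewrite !gt_eqF.
rewrite powRM ?powR_ge0 ?divr_ge0 ?mulr_ge0 ?powR_ge0 ?(ltW w0)//.
rewrite -[(w `^ _) `^ _]powRrM.
have -> : (1 - m^-1) * p = 1.
  have m1n0 : m - 1 != 0 by rewrite subr_eq0 gt_eqF.
  by rewrite /p; field; rewrite ?m1n0 ?gt_eqF.
by rewrite powRr1 ?(ltW w0)// mulfK// gt_eqF.
Qed.

(* With w^-1 = cos (arg z): the left-hand side is the interpolation error plus the
   sum of the coefficients times the real-time bound. *)
Lemma complex_time_bound (R : realType) (C1 c1 M w : R) (n : nat) :
  0 < C1 -> 0 < c1 -> 0 <= M -> 1 <= w ->
  n%:R <= c1 * M / 10 < n.+1%:R ->
  expR (- (w^-1 * n%:R / 8)) + 4 * expR (5 * n%:R) * (C1 * expR (- c1 * M)) <=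
  (expR 1 + 4 * C1) * expR (- (c1 / 80) * (M / w)).
Proof.
move=> C0 c0 M0 w1 /andP[nM Mn].
have w0 : 0 < w by exact: lt_le_trans w1.
have v1 : w^-1 <= 1 by rewrite invf_le1.
have v0 : 0 < w^-1 by rewrite invr_gt0.
(* Rounding n down loses less than 1, and [expR 1] pays for it; 80 = 8 * 10. *)
rewrite -[n.+1%:R]natr1 in Mn; rewrite [leRHS]mulrDl lerD//.
  rewrite -expRD ler_expR.
  move: v1 v0 nM Mn; move: (w^-1) => v; move: (n%:R) => k v1 v0 nM Mn.
  have : v * (c1 * M / 10) <= v * (k + 1) by apply: ler_wpM2l; exact: ltW.
  lra.
(* As 10 = 2 * 5, the coefficients use at most half of the exponent c1 M. *)
have -> : 4 * expR (5 * n%:R) * (C1 * expR (- c1 * M)) =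
    4 * C1 * (expR (5 * n%:R) * expR (- c1 * M)) by ring.
rewrite ler_pM2l ?mulr_gt0// -expRD ler_expR.
have : c1 * M * w^-1 <= c1 * M by rewrite ler_piMr// mulr_ge0// ltW.
have : 0 <= c1 * M by rewrite mulr_ge0// ltW.
move: nM; move: (n%:R) (w^-1) => k v; lra.
Qed.

(** All nodes are at most |z|, so the bound at time |z| serves for all of them. *)
Lemma real_time_bound_mono (R : realType) (C c D a s N p : R) :
  0 < C -> 0 < c -> 0 <= D -> 0 <= a -> 0 <= p -> 0 < s -> s <= N ->
  C * expR (- c * (D / s `^ a) `^ p) <= C * expR (- c * (D / N `^ a) `^ p).
Proof.
move=> C0 c0 D0 a0 p0 s0 sN; have N0 : 0 < N by exact: lt_le_trans sN.
have sN_a : s `^ a <= N `^ a.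
  by apply: ge0_ler_powR; rewrite ?nnegrE ?(ltW N0) ?(ltW s0).
have DsN : D / N `^ a <= D / s `^ a.
  apply: ler_wpM2l; first exact: D0.
  by rewrite lef_pV2 ?posrE ?powR_gt0.
rewrite (ler_pM2l C0).
rewrite ler_expR.
apply: ler_wnM2l; first by rewrite oppr_le0 ltW.
apply: ge0_ler_powR; first exact: p0.
- by rewrite nnegrE divr_ge0 ?powR_ge0.
- by rewrite nnegrE divr_ge0 ?powR_ge0.
exact: DsN.
Qed.

Lemma normL2_sum (R : realType) (d : measure_display) (X : measurableType d)
  (mu : {measure set X -> \bar R}) n (f : nat -> L2 mu) (M : nat -> R) :
  (forall k, (k < n)%N -> normL2 (f k) <= M k) ->
  normL2 (\sum_(k < n) f k) <= \sum_(k < n) M k.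
Proof.
elim: n => [|n IH] fM; first by rewrite !big_ord0 normL2_0.
rewrite !big_ord_recr/=; apply: (le_trans (normL2D _ _)); apply: lerD.
  by apply: IH => k kn; apply: fM; exact: ltnW.
exact: fM.
Qed.

Lemma restrictL2_sum (R : realType) (d : measure_display) (X : measurableType d)
  (mu : {measure set X -> \bar R}) n (f : nat -> L2 mu) (A : set X) :
  measurable A ->
  restrictL2 A (\sum_(k < n) f k) = \sum_(k < n) restrictL2 A (f k).
Proof.
move=> mA; elim: n => [|n IH]; first by rewrite !big_ord0 restrictL2_0.
by rewrite !big_ord_recr/= restrictL2D// IH.
Qed.

Theorem lemma3p3 (R : realType) (d : measure_display) (X : borelMetricType R d)
    (mu : {measure set X -> \bar R}) (m : R) (L : unbounded_op mu)
    (Phi : (R -> R[i]) -> L2 mu -> L2 mu) :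
  homogeneous_type mu ->
  2 <= m ->
  selfadjoint L ->
  nonnegative L ->
  spectral_calculus L Phi ->
  DaviesGaffney m Phi ->
  exists C c : R, [/\ 0 < C, 0 < c &
    forall (j : nat) (tau rho : R) (x : X) (r : R),
      (2 <= j)%N -> 0 < rho -> 0 < r ->
      (opnorm (restrictL2 (ball x r)
               \o expL Phi ((-1 +i* tau) * (rho^-1)%:C)
               \o restrictL2 (annulus x r j))%R
       <= (C * expR (- c *
             (rho `^ m^-1 * (2 ^+ j * r) / Num.sqrt (1 + tau ^+ 2))
               `^ (m / (m - 1))))%:E)%E].
Proof.
move=> hmu m2 _ _ calc [C [c [C0 c0 DG]]].
have m1 : 1 < m by rewrite (lt_le_trans _ m2)// ltr1n.
have m1_gt0 : 0 < m - 1 by rewrite subr_gt0.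
set p := m / (m - 1).
have p1 : 1 <= p by rewrite ler_pdivlMr// mul1r gerBl.
have p0 : 0 <= p by exact: le_trans p1.
have [C1 [c1 [C10 c10 off]]] := off_diagonal_bound hmu C0 c0 p1.
exists (expR 1 + 4 * C1), (c1 / 80); split.
- by rewrite addr_gt0 ?expR_gt0// mulr_gt0.
- by rewrite divr_gt0.
move=> j tau rho x r j2 rho0 r0.
set D := 2 ^+ j * r.
have D0 : 0 < D by rewrite mulr_gt0// exprn_gt0.
set w := Num.sqrt (1 + tau ^+ 2).
have w1 : 1 <= w by rewrite -[leLHS]sqrtr1 ler_wsqrtr// lerDl sqr_ge0.
have w0 : 0 < w by exact: lt_le_trans w1.
(* The operator is e^{-zL} with |z| = w / rho and Re z = 1 / rho, so 1 / w = cos (arg z). *)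
set z := - ((-1 +i* tau) * (rho^-1)%:C).
have ReZ : complex.Re z = rho^-1 by rewrite /z /=; ring.
have normZ : normc z = w / rho.
  rewrite /z normcN normcM normc_real ger0_norm ?invr_ge0 ?(ltW rho0)//.
  by rewrite /w /normc sqrrN expr1n.
have z0 : 0 < complex.Re z by rewrite ReZ invr_gt0.
set M := (D / (normc z) `^ m^-1) `^ p.
have M0 : 0 <= M by exact: powR_ge0.
set n := Num.truncn (c1 * M / 10).
have nM : n%:R <= c1 * M / 10 < n.+1%:R.
  by apply: truncn_itv; rewrite divr_ge0// mulr_ge0// ltW.
have [b [s [sz bsum bE]]] := exp_approximation n z0.
apply: ub_ereal_sup => _ [u /= u1 <-]; rewrite lee_fin.
set E := ball x r; set U := annulus x r j.
have mE : measurable E by exact: measurable_ball_borel.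
have mU : measurable U by apply: measurableD; exact: measurable_ball_borel.
(* This is where j >= 2 enters: D / 4 = 2^(j-2) r is at least r. *)
have ED : E `<=` ball x (D / 4).
  move=> y /mem_ball xy; apply/mem_ball; apply: (lt_le_trans xy).
  have -> : D / 4 = 2 ^+ (j - 2) * r.
    by rewrite /D -{1}(subnKC j2) exprD; field.
  by rewrite ler_peMl ?(ltW r0)// exprn_ege1// ler1n.
have UD : U `<=` ball x D `\` ball x (D / 2).
  rewrite (_ : D / 2 = 2 ^+ j.-1 * r)//.
  by rewrite /D -{1}(prednK (ltnW j2)) exprS; field.
set v := restrictL2 U u.
have v1 : normL2 v <= 1 by exact: le_trans (normL2_restrict _ mU) u1.
pose e k l : R[i] := cexp (- (s k)%:C * l%:C).
have eb k : (k < n)%N -> bounded_borel (e k).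
  move=> /sz /andP[sk _]; apply: bounded_borel_cexp.
  by rewrite /= oppr_le0 ltW.
(* The scalar error is itself a bounded Borel function, so the calculus turns its sup bound on [0,
   oo) into an operator bound. *)
pose dl l : R[i] := cexp (- z * l%:C) - \sum_(k < n) b k * e k l.
have dlb : bounded_borel dl.
  apply: bounded_borelD.
    apply: bounded_borel_cexp.
    by rewrite (_ : complex.Re (- z) = - complex.Re z) ?oppr_le0 ?(ltW z0)//; case: (z).
  rewrite (_ : (fun l => _) = (fun l => -1 * \sum_(k < n) b k * e k l)).
    exact/bounded_borelZ/bounded_borel_sum.
  by apply/funext => l; rewrite mulN1r.
have -> : expL Phi ((-1 +i* tau) * (rho^-1)%:C) v =
    Phi dl v + \sum_(k < n) b k *: Phi (e k) v.
  rewrite -(calculus_sum calc)// -(calculusD calc)//; last exact: bounded_borel_sum.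
  by congr Phi; apply/funext => l; rewrite /dl subrK /z opprK.
rewrite restrictL2D// (restrictL2_sum n (fun k => b k *: Phi (e k) v))//; apply: (le_trans (normL2D _ _)).
have bound1 : normL2 (restrictL2 E (Phi dl v)) <= expR (- (w^-1 * n%:R / 8)).
  apply: (le_trans (normL2_restrict _ mE)).
  have -> : w^-1 = complex.Re z / normc z.
    by rewrite ReZ normZ; field; rewrite !gt_eqF.
  apply: (le_trans (calculus_bound calc (M := expR (- (complex.Re z / normc z * n%:R / 8))) v dlb _)).
    by move=> l l0; exact: bE.
  by rewrite ler_piMr// expR_ge0.
have bound2 k : (k < n)%N ->
    normL2 (restrictL2 E (b k *: Phi (e k) v)) <=
    normc (b k) * (C1 * expR (- c1 * M)).
  move=> kn; have /andP[sk0 skz] := sz k kn.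
  rewrite restrictL2Z//; apply: (le_trans (normL2Z _ _)).
  rewrite ler_wpM2l ?normc_ge0//.
  have sm0 : 0 < s k `^ m^-1 by rewrite powR_gt0.
  have eE : expL Phi (- s k)%:C = Phi (e k).
    by apply/funext => q; congr Phi; apply/funext => l; rewrite /e rmorphN.
  apply: (@le_trans _ _ (C1 * expR (- c1 * (D / s k `^ m^-1) `^ p))).
    apply: (off (Phi (e k)) (s k `^ m^-1) _ _ _ _ x) => //.
    - exact: calculus_linear calc _ (eb _ kn).
    - move=> q; rewrite -[leRHS]mul1r; apply: (calculus_bound calc) (eb _ kn) _.
      by apply: bounded_by_cexp; rewrite /= oppr_le0 ltW.
    - by move=> y y'; rewrite -eE; exact: DG.
  apply: real_time_bound_mono C10 c10 (ltW D0) _ p0 sk0 skz.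
  by rewrite invr_ge0 (le_trans _ m2).
apply: (le_trans (lerD bound1 (normL2_sum bound2))).
have V0 : 0 <= C1 * expR (- c1 * M) by exact: mulr_ge0 (ltW C10) (expR_ge0 _).
have ME : M / w = (rho `^ m^-1 * D / w) `^ p.
  by rewrite /M normZ; exact: powR_rescale rho0 w0 (ltW D0) m1.
rewrite -ME; apply: le_trans (complex_time_bound C10 c10 M0 w1 nM).
rewrite -mulr_suml lerD2l; exact: ler_wpM2r V0 _ _ bsum.
Qed.
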